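(* Let $R>1$, let $E_R$ be the open Bernstein ellipse with foci $\pm1$ and sum of semi-axes $R$, and let $z\in E_R\setminus[-1,1]$. Put $$J^{-1}(z)=z+(z-1)\sqrt{\frac{z+1}{z-1}},\qquad \alpha(z)=1-\frac{\ln|J^{-1}(z)|}{\ln R}\in(0,1).$$ Then there exists $C>0$ such that for every $\epsilon>0$ and every $F\in H^\infty(E_R)$ with $\|F\|_{H^\infty(E_R)}\le1$ and $\|F\|_{L^\infty(-1,1)}\le\epsilon$ we have $$|F(z)|\le C\epsilon^{\alpha(z)}.$$ Moreover, this bound is asymptotically optimal as $\epsilon\to0$ and is attained by the function $$M(\zeta)=M_\epsilon(\zeta)=\epsilon^{2-\alpha(z)}\sum_{n=1}^\infty\frac{\left(\overline{J^{-1}(z)}\right)^nT_n(\zeta)}{1+\epsilon^2R^{2n}},$$ where $T_n$ is the Chebyshev polynomial of degree $n$, in the sense that there are constants $c_1,c_2,c_3,c_4,\epsilon_0>0$ (independent of $\epsilon$) such that for all $0<\epsilon<\epsilon_0$: $\|M_\epsilon\|_{H^\infty(E_R)}\le c_1$, $\|M_\epsilon\|_{L^\infty(-1,1)}\le c_2\epsilon$, and $c_3\epsilon^{\alpha(z)}\le|M_\epsilon(z)|\le c_4\epsilon^{\alpha(z)}$.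
   Context: $E_R$ is the open ellipse with foci at $\pm1$ and semi-axes $(R\pm R^{-1})/2$; its boundary is the image of the circle $|\omega|=R$ under the Joukowski map $J(\omega)=(\omega+\omega^{-1})/2$. $J^{-1}$ denotes the branch of the inverse of $J$ that is analytic in $E_R\setminus[-1,1]$ and satisfies $1<|J^{-1}(\zeta)|<R$ there (in the formula the square root is the principal branch). $H^\infty(E_R)$ is the space of bounded analytic functions in $E_R$ with the supremum norm. $T_n$ is determined by $T_n(x)=\cos(n\cos^{-1}x)$ for $x\in[-1,1]$. *)

(* Defs.v *)
From Stdlib Require Import Reals Lra Lia.
From Coquelicot Require Import Coquelicot.
Open Scope R_scope.

(** * Bernstein ellipses *)

(** Points whose distances to the foci 1 and -1 add up to less than the major
    axis [rho + / rho]; [bernstein_ellipse_axes] gives the Cartesian equation. *)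
Definition bernstein_ellipse (rho : R) (zeta : C) : Prop :=
  Cmod (zeta - 1)%C + Cmod (zeta + 1)%C < rho + / rho.

Definition segment (zeta : C) : Prop :=
  exists x : R, -1 <= x <= 1 /\ zeta = RtoC x.

Lemma bernstein_ellipse_axes (rho : R) (zeta : C) : 1 < rho ->
  bernstein_ellipse rho zeta <->
  (Re zeta / ((rho + / rho) / 2)) ^ 2 + (Im zeta / ((rho - / rho) / 2)) ^ 2 < 1.
Proof.
intros hr; destruct zeta as [x y]; unfold bernstein_ellipse, Re, Im; simpl fst; simpl snd.
assert (hi : 0 < / rho < 1).
{ split; [apply Rinv_0_lt_compat; lra|].
  rewrite <- Rinv_1; apply Rinv_lt_contravar; lra. }
assert (hri : rho * / rho = 1) by (field; lra).
set (a := (rho + / rho) / 2); set (b := (rho - / rho) / 2).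
assert (hab : a ^ 2 - b ^ 2 = 1) by (unfold a, b; nra).
assert (ha : 0 < a) by (unfold a; lra).
assert (hb : 0 < b) by (unfold b; lra).
replace (rho + / rho) with (2 * a) by (unfold a; lra).
set (p := Cmod ((x, y) - 1)%C); set (q := Cmod ((x, y) + 1)%C).
assert (hp0 : 0 <= p) by apply Cmod_ge_0.
assert (hq0 : 0 <= q) by apply Cmod_ge_0.
assert (hp : p ^ 2 = (x - 1) ^ 2 + y ^ 2).
{ unfold p, Cmod; rewrite pow2_sqrt; [simpl; ring | nra]. }
assert (hq : q ^ 2 = (x + 1) ^ 2 + y ^ 2).
{ unfold q, Cmod; rewrite pow2_sqrt; [simpl; ring | nra]. }
clearbody p q.
set (S := (p + q) / 2); set (D := (q - p) / 2).
assert (hx : x = S * D) by (unfold S, D; nra).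
assert (hy : y ^ 2 = (S ^ 2 - 1) * (1 - D ^ 2)).
{ assert (S ^ 2 + D ^ 2 = x ^ 2 + y ^ 2 + 1) by (unfold S, D; nra).
  replace ((S ^ 2 - 1) * (1 - D ^ 2)) with (S ^ 2 + D ^ 2 - 1 - (S * D) ^ 2) by ring.
  rewrite <- hx; lra. }
assert (hDS : D ^ 2 <= S ^ 2) by (unfold S, D; nra).
assert (hD : D ^ 2 <= 1).
{ destruct (Rle_or_lt (D ^ 2) 1) as [h | h]; [exact h |].
  assert (0 <= y ^ 2) by nra. nra. }
assert (hS : 0 <= S) by (unfold S; lra).
assert (heq : (x / a) ^ 2 + (y / b) ^ 2 - 1
              = (S ^ 2 - a ^ 2) * ((a ^ 2 - D ^ 2) / (a ^ 2 * b ^ 2))).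
{ replace ((x / a) ^ 2 + (y / b) ^ 2) with (x ^ 2 / a ^ 2 + y ^ 2 / b ^ 2)
    by (field; lra).
  rewrite hy, hx.
  apply (Rmult_eq_reg_r (a ^ 2 * b ^ 2)); [| nra].
  field_simplify; [| lra | lra].
  replace (b ^ 2) with (a ^ 2 - 1) by lra; ring. }
assert (hk : 0 < (a ^ 2 - D ^ 2) / (a ^ 2 * b ^ 2)).
{ apply Rdiv_lt_0_compat; nra. }
set (k := (a ^ 2 - D ^ 2) / (a ^ 2 * b ^ 2)) in *; clearbody k.
replace (p + q) with (2 * S) by (unfold S; lra).
split; intros h.
- assert (S ^ 2 < a ^ 2) by nra. nra.
- assert (S ^ 2 < a ^ 2) by nra. nra.
Qed.

(** * The exterior inverse of the Joukowski map *)

(** Principal square root; on the negative real axis it takes values in [i R_+]. *)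
Definition Csqrt (w : C) : C :=
  let u := sqrt ((Cmod w + Re w) / 2) in
  let v := sqrt ((Cmod w - Re w) / 2) in
  (u, if Rle_dec 0 (Im w) then v else - v).

Lemma Csqrt_sqr (w : C) : (Csqrt w * Csqrt w)%C = w.
Proof.
destruct w as [x y]; unfold Csqrt, Re, Im; simpl fst; simpl snd.
set (m := Cmod (x, y)).
assert (hm0 : 0 <= m) by apply Cmod_ge_0.
assert (hm : m * m = x * x + y * y).
{ unfold m, Cmod; rewrite sqrt_sqrt; simpl; nra. }
assert (hu : 0 <= (m + x) / 2) by nra.
assert (hv : 0 <= (m - x) / 2) by nra.
set (u := sqrt ((m + x) / 2)); set (v := sqrt ((m - x) / 2)).
assert (huu : u * u = (m + x) / 2) by now apply sqrt_sqrt.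
assert (hvv : v * v = (m - x) / 2) by now apply sqrt_sqrt.
assert (huv : 2 * (u * v) = Rabs y).
{ unfold u, v; rewrite <- sqrt_mult by assumption.
  replace ((m + x) / 2 * ((m - x) / 2)) with (Rsqr (y / 2)) by (unfold Rsqr; nra).
  rewrite sqrt_Rsqr_abs; unfold Rdiv; rewrite Rabs_mult, (Rabs_pos_eq (/ 2)) by lra.
  lra. }
unfold Cmult; simpl.
destruct (Rle_dec 0 y) as [h | h].
- rewrite Rabs_pos_eq in huv by lra. f_equal; lra.
- rewrite Rabs_left in huv by lra. f_equal; lra.
Qed.

Lemma Csqrt_Re (w : C) : 0 <= Re (Csqrt w).
Proof. apply sqrt_pos. Qed.

Definition Jinv (z : C) : C :=
  (z + (z - 1) * Csqrt ((z + 1) / (z - 1)))%C.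

Definition alpha (rho : R) (z : C) : R :=
  1 - ln (Cmod (Jinv z)) / ln rho.

(** * Function spaces *)

Definition analytic_on (D : C -> Prop) (F : C -> C) : Prop :=
  forall z : C, D z ->
  exists (r : R) (a : nat -> C), 0 < r /\
    forall h : C, Cmod h < r ->
      is_pseries (K := C_AbsRing) (V := C_NormedModule) a h (F (z + h)%C).

(** Elements of the spaces below are represented by total functions [C -> C];
    only their values on the domain matter. *)
Definition Hinf (D : C -> Prop) (F : C -> C) : Prop :=
  analytic_on D F /\ exists B : R, forall z : C, D z -> Cmod (F z) <= B.

Definition Hinf_norm (D : C -> Prop) (F : C -> C) : Rbar :=
  Lub_Rbar (fun r => exists z : C, D z /\ r = Cmod (F z)).

Definition Lebesgue_null (A : R -> Prop) : Prop :=
  forall eta : R, 0 < eta ->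
  exists l r : nat -> R,
    (forall n, l n <= r n) /\
    (forall x, A x -> exists n, l n < x < r n) /\
    (forall N, sum_f_R0 (fun n => r n - l n) N <= eta).

(** Essential supremum of [|f|] over [(a, b)]. *)
Definition Linf_norm (a b : R) (f : R -> C) : Rbar :=
  Glb_Rbar (fun c => 0 <= c /\
    Lebesgue_null (fun x => a < x < b /\ c < Cmod (f x))).

(** * Chebyshev polynomials *)

Fixpoint chebT (n : nat) (zeta : C) : C :=
  match n with
  | O => 1%C
  | S m => match m with
           | O => zeta
           | S k => (2 * zeta * chebT m zeta - chebT k zeta)%C
           end
  end.

Lemma chebT_cos (n : nat) (x : R) : -1 <= x <= 1 ->
  chebT n (RtoC x) = RtoC (cos (INR n * acos x)).
Proof.
intros hx.
enough (H : chebT n (RtoC x) = RtoC (cos (INR n * acos x)) /\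
            chebT (S n) (RtoC x) = RtoC (cos (INR (S n) * acos x))) by apply H.
induction n as [| n [IH1 IH2]].
- simpl; rewrite Rmult_0_l, cos_0, Rmult_1_l, cos_acos by lra; auto.
- split; [exact IH2 |].
  change (chebT (S (S n)) (RtoC x))
    with (2 * RtoC x * chebT (S n) (RtoC x) - chebT n (RtoC x))%C.
  rewrite IH1, IH2, <- !RtoC_mult, <- RtoC_minus; f_equal.
  set (t := acos x).
  replace x with (cos t) by (apply cos_acos; lra).
  replace (INR (S (S n)) * t) with (INR (S n) * t + t)
    by (rewrite (S_INR (S n)); ring).
  replace (INR n * t) with (INR (S n) * t - t) by (rewrite (S_INR n); ring).
  rewrite cos_plus, cos_minus; ring.
Qed.

(** * The optimal function *)

(** Sum of a complex series, taken componentwise; it is meaningful only when the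
    series converges. *)
Definition CSeries (a : nat -> C) : C :=
  (Series (fun n => Re (a n)), Series (fun n => Im (a n))).

Lemma is_series_CSeries (a : nat -> C) (l : C) :
  is_series (K := C_AbsRing) (V := C_NormedModule) a l -> CSeries a = l.
Proof.
intros H.
assert (Hc : forall pr : C -> R, (forall u v, pr (u + v)%C = pr u + pr v) ->
  (forall u, Rabs (pr u) <= Cmod u) -> Series (fun n => pr (a n)) = pr l).
{ intros pr hadd hle; apply is_series_unique.
  assert (hsub : forall u v, pr (u - v)%C = pr u - pr v).
  { intros u v; replace (pr u) with (pr ((u - v) + v)%C) by (f_equal; ring).
    rewrite hadd; ring. }
  assert (hsum : forall n, sum_n (fun k => pr (a k)) n = pr (sum_n a n)).
  { induction n as [| n IH]; [now rewrite !sum_O |].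
    rewrite !sum_Sn, IH; symmetry; apply hadd. }
  apply filterlim_locally; intros eps.
  generalize (proj1 (filterlim_locally_ball_norm (K := C_AbsRing) (U := C_NormedModule)
    (sum_n a) l) H eps).
  apply filter_imp; intros n hn.
  change (Rabs (sum_n (fun k => pr (a k)) n - pr l) < eps).
  rewrite hsum, <- hsub.
  apply Rle_lt_trans with (1 := hle _); exact hn. }
unfold CSeries.
rewrite (Hc Re), (Hc Im); [now destruct l | | | |].
- reflexivity.
- intros u; generalize (Rmax_Cmod u); apply Rle_trans; apply Rmax_r.
- reflexivity.
- intros u; generalize (Rmax_Cmod u); apply Rle_trans; apply Rmax_l.
Qed.

(** Term of index [n + 1] of the series, so that the sum starts at [n = 1]. *)
Definition M_term (rho : R) (z : C) (eps : R) (zeta : C) (n : nat) : C :=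
  (Cpow (Cconj (Jinv z)) (S n) * chebT (S n) zeta
   / RtoC (1 + eps ^ 2 * rho ^ (2 * S n)))%C.

Definition M (rho : R) (z : C) (eps : R) (zeta : C) : C :=
  (RtoC (Rpower eps (2 - alpha rho z)) * CSeries (M_term rho z eps zeta))%C.

(* Main.v *)
(** With [w = Jinv z], [z] lies in the ellipse of parameter [rho] but off
    [[-1, 1]] exactly when [1 < |w| < rho], since
    [|J w - 1| + |J w + 1| = |w| + 1 / |w|].

    Upper bound: for the integer [n] with [eps rho^n <= 1 < eps rho^(n+1)], the
    maximum principle on [1 <= |w| <= rho'], [rho' -> rho], applied to
    [F (J w) w^(-n)] gives [|F (J w)| <= 2 (|w| / rho)^n], which is
    [eps^alpha] up to a constant.

    Optimality: [T_n (J w) = (w^n + w^(-n)) / 2] reduces every norm of [M] to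
    [sum_n x^n / (1 + eps^2 rho^(2n))] with [x = |w| rho], [|w|] and [|w|^2]
    respectively. As [1 < x < rho^2], the sum is comparable with its largest
    term, at [rho^n ~ 1 / eps]. At [z] itself all terms have nonnegative real
    part, so that one term already gives the lower bound. *)

Require Import Defs.
From Stdlib Require Import Reals Lra Lia ClassicalEpsilon.
From Coquelicot Require Import Coquelicot.
Open Scope R_scope.

(** * The Joukowski map *)

(** Analyticity is given by local power series alone, so the usual consequences of Cauchy's formula
    are replaced by algebra on series. Two replacements shape the proof. For the maximum principle,
    a Taylor expansion to second order with cubic error is enough, and this weaker property passes
    easily to [F (J w) w^(-n)]. For the analyticity of [M], the coefficients of [T_n] recentred at a
    point of the ellipse must be [O(rho^n d^(-k))] with one radius [d] for all [n]; Cauchy's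
    estimate would give this, and here it is read off the three-term recursion.

    The real number [lam = - ln eps / ln rho], for which [eps rho^lam = 1], governs all powers of
    [eps]: with [|w| = rho^beta] and [beta = 1 - alpha], one has [(|w| / rho)^lam = eps^alpha], and
    [eps^(1 + beta)] is exactly the factor that normalises [(|w| rho)^lam] to 1. Rounding [lam] to
    an integer costs only fixed powers of [|w|] and [rho], which go into the constants. *)

Definition joukowski (w : C) : C := ((w + / w) / 2)%C.

Lemma Cneq_0_of_Cmod (w : C) : 0 < Cmod w -> w <> RtoC 0.
Proof. apply Cmod_gt_0. Qed.

Lemma Cmod_two : Cmod 2 = 2.
Proof. rewrite Cmod_R; apply Rabs_pos_eq; lra. Qed.

Lemma Ctwo_neq_0 : RtoC 2 <> RtoC 0.
Proof. apply Cneq_0_of_Cmod; rewrite Cmod_two; lra. Qed.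

Lemma Cmod_triangle_minus (u v : C) : Cmod (u - v) <= Cmod u + Cmod v.
Proof. rewrite <- (Cmod_opp v); apply Cmod_triangle. Qed.

Lemma Cmod_triangle_shift (u h : C) : Cmod u <= Cmod (u + h) + Cmod h.
Proof.
generalize (Cmod_triangle_minus (u + h) h).
now replace (u + h - h)%C with u by ring.
Qed.

Lemma Cinv_unique (u v : C) : (u * v)%C = 1 -> v = (/ u)%C.
Proof.
intros h.
assert (hu : u <> 0) by (intros h0; rewrite h0, Cmult_0_l in h; now apply C1_nz).
replace v with (u * v * / u)%C by (field; auto).
rewrite h; ring.
Qed.

(** [J w - 1] and [J w + 1] are [(w - 1)^2 / (2w)] and [(w + 1)^2 / (2w)], so the parallelogram law
    evaluates the sum of the two moduli. *)
Lemma joukowski_foci (w : C) : w <> 0 ->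
  Cmod (joukowski w - 1) + Cmod (joukowski w + 1) = Cmod w + / Cmod w.
Proof.
intros hw.
assert (hm : 0 < Cmod w) by now apply Cmod_gt_0.
assert (h2 : RtoC 2 <> 0) by apply Ctwo_neq_0.
replace (joukowski w - 1)%C with ((w - 1) * (w - 1) / (2 * w))%C
  by (unfold joukowski; field; auto).
replace (joukowski w + 1)%C with ((w + 1) * (w + 1) / (2 * w))%C
  by (unfold joukowski; field; auto).
rewrite !Cmod_div by (now apply Cmult_neq_0).
rewrite !Cmod_mult, Cmod_two.
assert (e : Cmod (w - 1) ^ 2 + Cmod (w + 1) ^ 2 = 2 * Cmod w ^ 2 + 2).
{ rewrite !Cmod2_alt; destruct w as [x y]; simpl; ring. }
apply (Rmult_eq_reg_r (2 * Cmod w)); [|lra].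
field_simplify; [|lra|lra].
simpl in e |- *; lra.
Qed.

Lemma inv_sum_lt (m rho : R) : 1 < rho -> 1 <= m ->
  (m + / m < rho + / rho <-> m < rho).
Proof.
intros hr hm.
assert (e : rho + / rho - (m + / m) = (rho - m) * (1 - / (rho * m))) by (field; lra).
assert (hp : / (rho * m) < 1).
{ rewrite <- Rinv_1; apply Rinv_lt_contravar; nra. }
split; intros h; nra.
Qed.

Lemma bernstein_joukowski (rho : R) (w : C) : 1 < rho -> 1 <= Cmod w ->
  (bernstein_ellipse rho (joukowski w) <-> Cmod w < rho).
Proof.
intros hr hw; unfold bernstein_ellipse.
rewrite joukowski_foci by (apply Cneq_0_of_Cmod; lra).
now apply inv_sum_lt.
Qed.

Lemma joukowski_inv (w : C) : w <> 0 -> joukowski (/ w) = joukowski w.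
Proof.
intros hw; assert (h2 := Ctwo_neq_0); unfold joukowski; field; auto.
Qed.

(** The roots of [w^2 - 2 zeta w + 1] have product 1, so one of them has modulus at least 1. *)
Lemma joukowski_surj (zeta : C) : exists w : C, 1 <= Cmod w /\ joukowski w = zeta.
Proof.
set (s := Csqrt (zeta * zeta - 1)).
assert (hs : (s * s)%C = (zeta * zeta - 1)%C) by apply Csqrt_sqr.
assert (hp : ((zeta + s) * (zeta - s) = 1)%C).
{ replace ((zeta + s) * (zeta - s))%C with (zeta * zeta - s * s)%C by ring.
  rewrite hs; ring. }
assert (hne : (zeta + s)%C <> 0).
{ intros h; rewrite h, Cmult_0_l in hp. apply C1_nz; auto. }
assert (hi := Cinv_unique _ _ hp).
assert (hj : joukowski (zeta + s) = zeta).
{ unfold joukowski; rewrite <- hi; field; apply Ctwo_neq_0. }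
destruct (Rle_or_lt 1 (Cmod (zeta + s))) as [h | h].
- now exists (zeta + s)%C.
- exists (/ (zeta + s))%C; split; [|now rewrite joukowski_inv].
  rewrite Cmod_inv by auto.
  assert (0 < Cmod (zeta + s)) by now apply Cmod_gt_0.
  rewrite <- Rinv_1; apply Rinv_le_contravar; lra.
Qed.

(** With [s] the square root in [Jinv], [Jinv z = (s + 1) / (s - 1)]. This Moebius map carries the
    half-plane [Re s > 0] to the exterior of the unit disc. The principal branch gives [Re s >= 0],
    and the imaginary axis is what the segment excludes. *)
Lemma Jinv_spec (rho : R) (z : C) : 1 < rho -> bernstein_ellipse rho z -> ~ segment z ->
  1 < Cmod (Jinv z) < rho /\ joukowski (Jinv z) = z.
Proof.
intros hr hz hs.
assert (hz1 : (z - 1)%C <> 0).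
{ intros h; apply hs; exists 1; split; [lra|].
  replace z with (z - 1 + 1)%C by ring; rewrite h; ring. }
set (s := Csqrt ((z + 1) / (z - 1))).
assert (hss : (s * s * (z - 1) = z + 1)%C).
{ unfold s; rewrite Csqrt_sqr; field; auto. }
assert (hre : 0 < Re s).
{ destruct (Csqrt_Re ((z + 1) / (z - 1))) as [h | h]; [exact h |].
  exfalso; apply hs; fold s in h.
  destruct s as [a b]; simpl in h; subst a.
  (* Solving [s^2 (z - 1) = z + 1] for [z] at [s = i b] gives this point of the segment. *)
  exists ((b * b - 1) / (b * b + 1)); split.
  - assert (0 < b * b + 1) by nra. split.
    + apply (Rmult_le_reg_r (b * b + 1)); [lra|]; field_simplify; nra.
    + apply (Rmult_le_reg_r (b * b + 1)); [lra|]; field_simplify; nra.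
  - assert (e : ((0, b) * (0, b))%C = RtoC (- (b * b))).
    { unfold Cmult, RtoC; simpl; f_equal; ring. }
    rewrite e in hss.
    assert (hd : RtoC (b * b + 1) <> 0).
    { intros h; apply RtoC_inj in h; nra. }
    rewrite RtoC_div by nra.
    replace (RtoC (b * b - 1)) with (RtoC (b * b + 1) * z)%C; [field; auto|].
    rewrite RtoC_opp in hss; rewrite RtoC_minus, RtoC_plus.
    replace ((RtoC (b * b) + 1) * z)%C with (z + 1 + RtoC (b * b) * z - 1)%C by ring.
    rewrite <- hss; ring. }
assert (hs1 : (s - 1)%C <> 0).
{ intros h. assert (h' : s = 1) by (replace s with (s - 1 + 1)%C by ring; rewrite h; ring).
  rewrite h' in hss.
  assert (h2 : RtoC 2 = 0).
  { replace (RtoC 2) with (z + 1 - 1 * 1 * (z - 1))%C by ring. rewrite hss; ring. }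
  now apply Ctwo_neq_0. }
assert (hJ : (Jinv z * (s - 1) = s + 1)%C).
{ unfold Jinv; fold s.
  replace ((z + (z - 1) * s) * (s - 1))%C with (s * s * (z - 1) - z + s)%C by ring.
  rewrite hss; ring. }
assert (hm1 : 1 < Cmod (Jinv z)).
{ assert (h : Cmod (Jinv z) * Cmod (s - 1) = Cmod (s + 1)) by now rewrite <- Cmod_mult, hJ.
  assert (p1 : 0 < Cmod (s - 1)) by now apply Cmod_gt_0.
  assert (p2 := Cmod_ge_0 (s + 1)).
  assert (hh : Cmod (s - 1) ^ 2 < Cmod (s + 1) ^ 2).
  { rewrite !Cmod2_alt; destruct s as [a b]; simpl in *; nra. }
  assert (Cmod (s - 1) < Cmod (s + 1)) by nra.
  nra. }
assert (hw : (z - (z - 1) * s)%C = (/ Jinv z)%C).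
{ apply Cinv_unique; unfold Jinv; fold s.
  replace ((z + (z - 1) * s) * (z - (z - 1) * s))%C
    with (z * z - (z - 1) * (s * s * (z - 1)))%C by ring.
  rewrite hss; ring. }
assert (hj : joukowski (Jinv z) = z).
{ unfold joukowski; rewrite <- hw; unfold Jinv; fold s; field; apply Ctwo_neq_0. }
split; [|exact hj]; split; [exact hm1|].
apply (bernstein_joukowski rho (Jinv z)); [lra|lra|now rewrite hj].
Qed.

Lemma chebT_joukowski (n : nat) (w : C) : w <> 0 ->
  chebT n (joukowski w) = ((w ^ n + / w ^ n) / 2)%C.
Proof.
intros hw.
assert (h2 := Ctwo_neq_0).
enough (H : chebT n (joukowski w) = ((w ^ n + / w ^ n) / 2)%C /\
            chebT (S n) (joukowski w) = ((w ^ S n + / w ^ S n) / 2)%C) by apply H.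
induction n as [| n [IH1 IH2]].
- simpl; unfold joukowski; split; field; auto.
- split; [exact IH2 |].
  change (chebT (S (S n)) (joukowski w))
    with (2 * joukowski w * chebT (S n) (joukowski w) - chebT n (joukowski w))%C.
  rewrite IH1, IH2; unfold joukowski; rewrite !Cpow_S.
  assert (hp : (w ^ n)%C <> 0) by now apply Cpow_nz.
  field; auto.
Qed.

Lemma Cmod_chebT_joukowski (n : nat) (w : C) : 1 <= Cmod w ->
  Cmod (chebT n (joukowski w)) <= Cmod w ^ n.
Proof.
intros hw.
assert (hw0 : w <> 0) by (apply Cneq_0_of_Cmod; lra).
assert (hp : (w ^ n)%C <> 0) by now apply Cpow_nz.
rewrite chebT_joukowski, Cmod_div, Cmod_two by (auto; apply Ctwo_neq_0).
assert (h := Cmod_triangle (w ^ n) (/ w ^ n)).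
rewrite Cmod_inv, Cmod_pow in h by auto.
assert (h1 : 1 <= Cmod w ^ n) by now apply pow_R1_Rle.
assert (/ Cmod w ^ n <= 1) by (rewrite <- Rinv_1; apply Rinv_le_contravar; lra).
lra.
Qed.

(** * A maximum principle on annuli *)

Definition bigO (k : nat) (e : C -> C) : Prop :=
  exists K d : R, 0 < d /\ forall h, Cmod h < d -> Cmod (e h) <= K * Cmod h ^ k.

Lemma bigO_ext (k : nat) (e e' : C -> C) :
  (exists d, 0 < d /\ forall h, Cmod h < d -> e h = e' h) -> bigO k e -> bigO k e'.
Proof.
intros (d0 & hd0 & he) (K & d & hd & H); exists K, (Rmin d0 d); split.
- now apply Rmin_glb_lt.
- intros h hh; rewrite <- he; [apply H|]; eapply Rlt_le_trans; try exact hh;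
  [apply Rmin_r | apply Rmin_l].
Qed.

Lemma bigO_ext_all (k : nat) (e e' : C -> C) :
  (forall h, e h = e' h) -> bigO k e -> bigO k e'.
Proof.
intros H; apply bigO_ext; exists 1; split; [lra|auto].
Qed.

(** Working form of [bigO]: a nonnegative constant lets two bounds be multiplied, and a radius at
    most 1 lets exponents be lowered. *)
Lemma bigO_nonneg (k : nat) (e : C -> C) : bigO k e ->
  exists K d : R, 0 <= K /\ 0 < d <= 1 /\ forall h, Cmod h < d -> Cmod (e h) <= K * Cmod h ^ k.
Proof.
intros (K & d & hd & H); exists (Rabs K), (Rmin d 1); repeat split.
- apply Rabs_pos.
- apply Rmin_glb_lt; lra.
- apply Rmin_r.
- intros h hh.
  apply Rle_trans with (K * Cmod h ^ k).
  + apply H; eapply Rlt_le_trans; [exact hh | apply Rmin_l].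
  + apply Rmult_le_compat_r; [apply pow_le, Cmod_ge_0 | apply Rle_abs].
Qed.

Lemma bigO_plus (k : nat) (e f : C -> C) :
  bigO k e -> bigO k f -> bigO k (fun h => e h + f h)%C.
Proof.
intros (K & d & hd & H) (K' & d' & hd' & H'); exists (K + K'), (Rmin d d'); split.
- now apply Rmin_glb_lt.
- intros h hh.
  assert (Cmod h < d) by (eapply Rlt_le_trans; [exact hh | apply Rmin_l]).
  assert (Cmod h < d') by (eapply Rlt_le_trans; [exact hh | apply Rmin_r]).
  specialize (H h ltac:(assumption)); specialize (H' h ltac:(assumption)).
  generalize (Cmod_triangle (e h) (f h)); lra.
Qed.

Lemma bigO_mult (j k : nat) (e f : C -> C) :
  bigO j e -> bigO k f -> bigO (j + k) (fun h => e h * f h)%C.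
Proof.
intros He Hf; destruct (bigO_nonneg _ _ He) as (K & d & hK & hd & H).
destruct (bigO_nonneg _ _ Hf) as (K' & d' & hK' & hd' & H').
exists (K * K'), (Rmin d d'); split.
- now apply Rmin_glb_lt.
- intros h hh.
  assert (Cmod h < d) by (eapply Rlt_le_trans; [exact hh | apply Rmin_l]).
  assert (Cmod h < d') by (eapply Rlt_le_trans; [exact hh | apply Rmin_r]).
  rewrite Cmod_mult, pow_add.
  replace (K * K' * (Cmod h ^ j * Cmod h ^ k)) with (K * Cmod h ^ j * (K' * Cmod h ^ k)) by ring.
  apply Rmult_le_compat; auto using Cmod_ge_0.
Qed.

Lemma bigO_weaken (j k : nat) (e : C -> C) : (k <= j)%nat -> bigO j e -> bigO k e.
Proof.
intros hjk He; destruct (bigO_nonneg _ _ He) as (K & d & hK & hd & H).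
exists K, d; split; [lra|]; intros h hh.
apply Rle_trans with (1 := H h hh); apply Rmult_le_compat_l; [exact hK|].
replace j with (k + (j - k))%nat by lia; rewrite pow_add.
assert (h0 := Cmod_ge_0 h).
assert (Cmod h ^ (j - k) <= 1) by (rewrite <- (pow1 (j - k)); apply pow_incr; lra).
assert (0 <= Cmod h ^ k) by now apply pow_le.
nra.
Qed.

Lemma bigO_const (c : C) : bigO 0 (fun _ => c).
Proof. exists (Cmod c), 1; split; [lra|]; intros; simpl; lra. Qed.

Lemma bigO_id : bigO 1 (fun h => h).
Proof. exists 1, 1; split; [lra|]; intros; simpl; lra. Qed.

Lemma bigO_scal (k : nat) (c : C) (e : C -> C) :
  bigO k e -> bigO k (fun h => c * e h)%C.
Proof. apply (bigO_mult 0 k), bigO_const. Qed.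

Lemma bigO_comp (k : nat) (e g : C -> C) :
  bigO k e -> bigO 1 g -> bigO k (fun h => e (g h)).
Proof.
intros He Hg; destruct (bigO_nonneg _ _ He) as (K & d & hK & hd & H).
destruct (bigO_nonneg _ _ Hg) as (L & d' & hL & hd' & H').
exists (K * L ^ k), (Rmin d' (d / (L + 1))); split.
- apply Rmin_glb_lt; [lra|]; apply Rdiv_lt_0_compat; lra.
- intros h hh.
  assert (h1 : Cmod h < d') by (eapply Rlt_le_trans; [exact hh | apply Rmin_l]).
  assert (h2 : Cmod h < d / (L + 1)) by (eapply Rlt_le_trans; [exact hh | apply Rmin_r]).
  specialize (H' h h1); simpl in H'; rewrite Rmult_1_r in H'.
  assert (h0 := Cmod_ge_0 h).
  assert (hg : Cmod (g h) < d).
  { apply Rle_lt_trans with (1 := H').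
    apply Rle_lt_trans with ((L + 1) * Cmod h); [nra|].
    apply (Rmult_lt_compat_l (L + 1)) in h2; [|lra].
    replace ((L + 1) * (d / (L + 1))) with d in h2 by (field; lra); lra. }
  apply Rle_trans with (1 := H _ hg).
  rewrite Rmult_assoc, <- Rpow_mult_distr.
  apply Rmult_le_compat_l; [exact hK|]; apply pow_incr; split; [apply Cmod_ge_0 | exact H'].
Qed.

(** Stands in for holomorphy at a point. The coefficients are complex, which is what makes the
    second-order part of [|f|^2] subharmonic, and products, compositions and inverses are handled by
    polynomial algebra instead of rearranged power series. *)
Definition second_order (f : C -> C) (z : C) : Prop :=
  exists a b : C, bigO 3 (fun h => f (z + h) - (f z + a * h + b * (h * h)))%C.

Lemma second_order_const (c z : C) : second_order (fun _ => c) z.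
Proof.
exists 0%C, 0%C; exists 0, 1; split; [lra|]; intros h _.
replace (c - (c + 0 * h + 0 * (h * h)))%C with (RtoC 0) by ring; rewrite Cmod_0; lra.
Qed.

Lemma second_order_id (z : C) : second_order (fun w => w) z.
Proof.
exists 1%C, 0%C; exists 0, 1; split; [lra|]; intros h _.
replace (z + h - (z + 1 * h + 0 * (h * h)))%C with (RtoC 0) by ring; rewrite Cmod_0; lra.
Qed.

Lemma second_order_plus (f g : C -> C) (z : C) :
  second_order f z -> second_order g z -> second_order (fun w => f w + g w)%C z.
Proof.
intros (a & b & H) (a' & b' & H'); exists (a + a')%C, (b + b')%C.
generalize (bigO_plus _ _ _ H H'); apply bigO_ext_all; intros h; simpl; ring.
Qed.

Lemma second_order_bounded (f : C -> C) (z : C) :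
  second_order f z -> bigO 1 (fun h => f (z + h) - f z)%C.
Proof.
intros (a & b & H).
assert (H1 : bigO 1 (fun h => a * h + b * (h * h))%C).
{ apply bigO_plus; apply bigO_scal; [apply bigO_id|].
  apply (bigO_weaken 2); [lia|]; apply (bigO_mult 1 1); apply bigO_id. }
generalize (bigO_plus _ _ _ (bigO_weaken 3 1 _ ltac:(lia) H) H1).
apply bigO_ext_all; intros h; simpl; ring.
Qed.

Lemma second_order_mult (f g : C -> C) (z : C) :
  second_order f z -> second_order g z -> second_order (fun w => f w * g w)%C z.
Proof.
intros Hf Hg.
assert (Bg := second_order_bounded _ _ Hg).
destruct Hf as (a & b & H); destruct Hg as (a' & b' & H').
exists (f z * a' + a * g z)%C, (f z * b' + a * a' + b * g z)%C.
set (ef := fun h => (f (z + h) - (f z + a * h + b * (h * h)))%C) in H.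
set (eg := fun h => (g (z + h) - (g z + a' * h + b' * (h * h)))%C) in H'.
assert (E1 : bigO 3 (fun h => ef h * ((g (z + h) - g z) + g z))%C).
{ apply (bigO_mult 3 0); [exact H|]; apply bigO_plus; [|apply bigO_const].
  apply (bigO_weaken 1); [lia | exact Bg]. }
assert (E2 : bigO 3 (fun h => (f z + (a * h + b * (h * h))) * eg h)%C).
{ apply (bigO_mult 0 3); [|exact H']; apply bigO_plus; [apply bigO_const|].
  apply bigO_plus; apply bigO_scal.
  - apply (bigO_weaken 1); [lia | apply bigO_id].
  - apply (bigO_weaken 2); [lia|]; apply (bigO_mult 1 1); apply bigO_id. }
(* The terms of degree 3 and 4 in the product of the two quadratic polynomials. *)
assert (E3 : bigO 3 (fun h => h * (h * (h * (a * b' + b * a' + b * b' * h))))%C).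
{ apply (bigO_mult 1 2); [apply bigO_id|]; apply (bigO_mult 1 1); [apply bigO_id|].
  apply (bigO_mult 1 0); [apply bigO_id|]; apply bigO_plus; [apply bigO_const|].
  apply bigO_scal, (bigO_weaken 1); [lia | apply bigO_id]. }
generalize (bigO_plus _ _ _ E1 (bigO_plus _ _ _ E2 E3)).
apply bigO_ext_all; intros h; unfold ef, eg; simpl; ring.
Qed.

Lemma second_order_pow (f : C -> C) (z : C) (n : nat) :
  second_order f z -> second_order (fun w => f w ^ n)%C z.
Proof.
intros H; induction n as [|n IH]; [exact (second_order_const 1 z)|].
exact (second_order_mult f (fun w => f w ^ n)%C z H IH).
Qed.

Lemma second_order_comp (f g : C -> C) (z : C) :
  second_order g z -> second_order f (g z) -> second_order (fun w => f (g w)) z.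
Proof.
intros Hg (a & b & H).
assert (Bg := second_order_bounded _ _ Hg).
destruct Hg as (a' & b' & H').
exists (a * a')%C, (a * b' + b * a' * a')%C.
set (k := fun h => (g (z + h) - g z)%C) in Bg.
set (eg := fun h => (g (z + h) - (g z + a' * h + b' * (h * h)))%C) in H'.
assert (E1 := bigO_comp _ _ _ H Bg).
assert (E2 := bigO_scal _ a _ H').
assert (Em : bigO 2 (fun h => eg h + b' * (h * h))%C).
{ apply bigO_plus; [apply (bigO_weaken 3); [lia | exact H']|].
  apply bigO_scal, (bigO_mult 1 1); apply bigO_id. }
(* The error of replacing [k^2] by [(a' h)^2], factored as a difference of squares:
   [k - a' h = eg + b' h^2] is already of order 2. *)
assert (E3 : bigO 3 (fun h => (b * (k h + a' * h)) * (eg h + b' * (h * h)))%C).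
{ apply (bigO_mult 1 2); [|exact Em].
  apply bigO_scal, bigO_plus; [exact Bg | apply bigO_scal, bigO_id]. }
generalize (bigO_plus _ _ _ E1 (bigO_plus _ _ _ E2 E3)).
apply bigO_ext_all; intros h; unfold k, eg; simpl.
replace (g z + (g (z + h) - g z))%C with (g (z + h)%C) by ring; ring.
Qed.

Lemma second_order_inv (z : C) : z <> 0 -> second_order Cinv z.
Proof.
intros hz; assert (hm : 0 < Cmod z) by now apply Cmod_gt_0.
exists (- / (z * z))%C, (/ (z * z * z))%C.
assert (hne : forall h, Cmod h < Cmod z / 2 -> Cmod z / 2 <= Cmod (z + h)).
{ intros h hh; generalize (Cmod_triangle_shift z h); lra. }
(* Exact remainder of the geometric expansion of [1 / (z + h)] after its quadratic term. *)
assert (E : bigO 3 (fun h => (- / (z * z * z)) * (h * (h * h)) * / (z + h))%C).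
{ apply (bigO_mult 3 0).
  - apply bigO_scal, (bigO_mult 1 2); [apply bigO_id|]; apply (bigO_mult 1 1); apply bigO_id.
  - exists (/ (Cmod z / 2)), (Cmod z / 2); split; [lra|].
    intros h hh; specialize (hne h hh).
    rewrite Cmod_inv by (apply Cneq_0_of_Cmod; lra); simpl; rewrite Rmult_1_r.
    apply Rinv_le_contravar; lra. }
revert E; apply bigO_ext; exists (Cmod z / 2); split; [lra|]; intros h hh.
specialize (hne h hh); field; split; apply Cneq_0_of_Cmod; lra.
Qed.

Lemma second_order_joukowski (w : C) : w <> 0 -> second_order joukowski w.
Proof.
intros hw; apply (second_order_mult (fun w => w + / w)%C (fun _ => / 2)%C).
- apply second_order_plus; [apply second_order_id | now apply second_order_inv].
- apply second_order_const.
Qed.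

(** Averaging over [h, i h, -h, -i h] kills the harmonic second-order terms of
    [|f|^2], so the perturbation [delta |w|^2] dominates the cubic error. *)
Lemma no_interior_max (f : C -> C) (w : C) (delta d : R) :
  second_order f w -> 0 < delta -> 0 < d ->
  ~ (forall h, Cmod h < d ->
       Cmod (f (w + h)%C) ^ 2 + delta * Cmod (w + h) ^ 2 <= Cmod (f w) ^ 2 + delta * Cmod w ^ 2).
Proof.
intros (a & b & H) hdl hd Hmax.
destruct (bigO_nonneg _ _ H) as (K & d' & hK & hd' & HK); clear H.
set (c := f w) in *.
set (B := Cmod c + Cmod a + Cmod b).
assert (hB : 0 <= B) by (unfold B; generalize (Cmod_ge_0 c) (Cmod_ge_0 a) (Cmod_ge_0 b); lra).
set (P := fun h => (c + a * h + b * (h * h))%C).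
(* Replacing [f] by its quadratic part [P] costs at most [2 B K t^3] in the squared modulus, because
   [|P h| <= B]. *)
assert (low : forall t h, 0 < t < d' -> Cmod h = t ->
  Cmod (P h) ^ 2 - 2 * B * K * t ^ 3 <= Cmod (f (w + h)%C) ^ 2).
{ intros t h ht hh.
  specialize (HK h ltac:(lra)); fold (P h) in HK; rewrite hh in HK.
  assert (h1 : Cmod (P h) <= Cmod (f (w + h)%C) + K * t ^ 3).
  { generalize (Cmod_triangle_minus (f (w + h)%C) (f (w + h)%C - P h)).
    replace (f (w + h)%C - (f (w + h)%C - P h))%C with (P h) by ring; lra. }
  assert (h2 : Cmod (P h) <= B).
  { unfold P, B; generalize (Cmod_triangle (c + a * h) (b * (h * h))) (Cmod_triangle c (a * h)).
    rewrite !Cmod_mult, hh.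
    assert (Cmod a * t <= Cmod a) by (generalize (Cmod_ge_0 a); nra).
    assert (t * t <= 1) by nra.
    assert (Cmod b * (t * t) <= Cmod b) by (generalize (Cmod_ge_0 b); nra).
    lra. }
  assert (p1 := Cmod_ge_0 (P h)); assert (p2 := Cmod_ge_0 (f (w + h)%C)).
  assert (p3 : 0 <= K * t ^ 3) by (apply Rmult_le_pos; [lra | apply pow_le; lra]).
  set (x := Cmod (P h)) in *; set (y := Cmod (f (w + h)%C)) in *; set (e := K * t ^ 3) in *.
  replace (2 * B * K * t ^ 3) with (2 * B * e) by (unfold e; ring).
  destruct (Rle_or_lt x e); nra. }
(* The first two bounds keep the four test points inside the domains of the hypothesis and of the
   expansion; the third makes the cubic error [2 B K t^3] smaller than [delta t^2]. *)
set (t := Rmin (d / 2) (Rmin (d' / 2) (delta / (2 * B * K + 1)))).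
assert (hBK : 0 <= 2 * B * K) by nra.
assert (ht : 0 < t).
{ unfold t; repeat apply Rmin_glb_lt; try lra; apply Rdiv_lt_0_compat; lra. }
assert (ht1 : t <= d / 2) by apply Rmin_l.
assert (ht2 : t <= d' / 2) by (eapply Rle_trans; [apply Rmin_r | apply Rmin_l]).
assert (ht3 : t <= delta / (2 * B * K + 1)) by (eapply Rle_trans; [apply Rmin_r | apply Rmin_r]).
assert (ht4 : 2 * B * K * t < delta).
{ apply (Rmult_le_compat_r (2 * B * K + 1)) in ht3; [|lra].
  replace (delta / (2 * B * K + 1) * (2 * B * K + 1)) with delta in ht3 by (field; lra); lra. }
clearbody t.
assert (m1 : Cmod (t, 0) = t).
{ change (t, 0) with (RtoC t); rewrite Cmod_R; apply Rabs_pos_eq; lra. }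
assert (m2 : Cmod (- t, 0) = t).
{ change (- t, 0) with (RtoC (- t)); rewrite Cmod_R, Rabs_Ropp; apply Rabs_pos_eq; lra. }
assert (m3 : Cmod (0, t) = t).
{ unfold Cmod; simpl; replace (0 * (0 * 1) + t * (t * 1)) with (Rsqr t) by (unfold Rsqr; ring).
  apply sqrt_Rsqr; lra. }
assert (m4 : Cmod (0, - t) = t).
{ unfold Cmod; simpl; replace (0 * (0 * 1) + - t * (- t * 1)) with (Rsqr t) by (unfold Rsqr; ring).
  apply sqrt_Rsqr; lra. }
assert (U1 := Hmax (t, 0) ltac:(lra)); assert (L1 := low t (t, 0) ltac:(lra) m1).
assert (U2 := Hmax (- t, 0) ltac:(lra)); assert (L2 := low t (- t, 0) ltac:(lra) m2).
assert (U3 := Hmax (0, t) ltac:(lra)); assert (L3 := low t (0, t) ltac:(lra) m3).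
assert (U4 := Hmax (0, - t) ltac:(lra)); assert (L4 := low t (0, - t) ltac:(lra) m4).
(* The cross terms of [|c + a h + b h^2|^2] are real parts of multiples of [h] or [h^2], whose sums
   over the four directions vanish. *)
assert (S1 : Cmod (P (t, 0)) ^ 2 + Cmod (P (- t, 0)) ^ 2 + Cmod (P (0, t)) ^ 2
   + Cmod (P (0, - t)) ^ 2
   = 4 * Cmod c ^ 2 + 4 * t ^ 2 * Cmod a ^ 2 + 4 * t ^ 4 * Cmod b ^ 2).
{ unfold P; rewrite !Cmod2_alt; destruct c, a, b; simpl; ring. }
assert (S2 : Cmod (w + (t, 0)) ^ 2 + Cmod (w + (- t, 0)) ^ 2 + Cmod (w + (0, t)) ^ 2
   + Cmod (w + (0, - t)) ^ 2 = 4 * Cmod w ^ 2 + 4 * t ^ 2).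
{ rewrite !Cmod2_alt; destruct w; simpl; ring. }
assert (0 <= 4 * t ^ 2 * Cmod a ^ 2) by (apply Rmult_le_pos; [nra | apply pow2_ge_0]).
assert (0 <= 4 * t ^ 4 * Cmod b ^ 2).
{ apply Rmult_le_pos; [|apply pow2_ge_0]; apply Rmult_le_pos; [lra|apply pow_le; lra]. }
assert (delta * (4 * t ^ 2) <= 4 * (2 * B * K * t ^ 3)).
{ replace (delta * (4 * t ^ 2)) with (delta * (4 * Cmod w ^ 2 + 4 * t ^ 2) - 4 * (delta * Cmod w ^ 2)) by ring.
  rewrite <- S2; lra. }
assert (0 < t ^ 2) by (apply pow_lt; lra).
replace (t ^ 3) with (t ^ 2 * t) in * by ring.
nra.
Qed.

(** * Attained maxima of upper semicontinuous functions *)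

Lemma rectangle_max (g : R -> R -> R) (a b a' b' B : R) :
  a <= b -> a' <= b' ->
  (forall x y, a <= x <= b -> a' <= y <= b' -> g x y <= B) ->
  (forall u v eta, a <= u <= b -> a' <= v <= b' -> 0 < eta ->
     exists d, 0 < d /\ forall x y, Rabs (x - u) < d -> Rabs (y - v) < d -> g x y < g u v + eta) ->
  exists u v, a <= u <= b /\ a' <= v <= b' /\
    forall x y, a <= x <= b -> a' <= y <= b' -> g x y <= g u v.
Proof.
intros hab hab' hB husc.
set (E := fun r => exists x y, a <= x <= b /\ a' <= y <= b' /\ r = g x y).
destruct (completeness E) as [S [hS1 hS2]].
{ exists B; intros r (x & y & hx & hy & ->); auto. }
{ exists (g a a'), a, a'; repeat split; lra. }
destruct (classic (exists u v, a <= u <= b /\ a' <= v <= b' /\ g u v = S)) as [(u & v & hu & hv & e)|hno].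
{ exists u, v; repeat split; try tauto; intros x y hx hy; rewrite e; apply hS1.
  now exists x, y. }
exfalso.
assert (hlt : forall u v, a <= u <= b -> a' <= v <= b' -> g u v < S).
{ intros u v hu hv; destruct (Rle_lt_or_eq_dec (g u v) S); [|assumption|].
  - apply hS1; now exists u, v.
  - exfalso; apply hno; now exists u, v. }
(* The radius is also at most half the gap to the supremum, so that a uniform
   lower bound on radii yields a uniform gap. *)
assert (hd : forall u v, exists d : posreal, a <= u <= b -> a' <= v <= b' ->
  d <= (S - g u v) / 2 /\
  forall x y, Rabs (x - u) < d -> Rabs (y - v) < d -> g x y < g u v + (S - g u v) / 2).
{ intros u v.
  destruct (classic (a <= u <= b /\ a' <= v <= b')) as [[hu hv]|hn];
    [|exists (mkposreal 1 Rlt_0_1); tauto].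
  specialize (hlt u v hu hv).
  destruct (husc u v ((S - g u v) / 2) hu hv ltac:(lra)) as (d & hd & H).
  assert (hp : 0 < Rmin d ((S - g u v) / 2)) by (apply Rmin_glb_lt; lra).
  exists (mkposreal _ hp); simpl; intros _ _; split; [apply Rmin_r|].
  intros x y h1 h2; apply H; (eapply Rlt_le_trans; [eassumption | apply Rmin_l]). }
set (delta := fun u v => proj1_sig (constructive_indefinite_description _ (hd u v))).
destruct (compactness_value_2d a b a' b' delta) as [d Hd].
assert (hub : is_upper_bound E (S - d)).
{ intros r (x & y & hx & hy & ->).
  apply Rnot_lt_le; intros hgt; apply (Hd x y hx hy).
  intros (u & v & hu & hv & h1 & h2 & h3).
  unfold delta in h1, h2, h3.
  destruct (constructive_indefinite_description _ (hd u v)) as [p Hp]; simpl in *.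
  destruct (Hp hu hv) as [q1 q2]; specialize (q2 x y h1 h2); lra. }
specialize (hS2 _ hub); generalize (cond_pos d); lra.
Qed.

Lemma annulus_max (f : C -> R) (r1 r2 B : R) (w0 : C) :
  r1 <= Cmod w0 <= r2 ->
  (forall w, r1 <= Cmod w <= r2 -> 0 <= f w <= B) ->
  (forall w eta, r1 <= Cmod w <= r2 -> 0 < eta ->
     exists d, 0 < d /\ forall h, Cmod h < d -> f (w + h)%C < f w + eta) ->
  exists w, r1 <= Cmod w <= r2 /\ forall w', r1 <= Cmod w' <= r2 -> f w' <= f w.
Proof.
intros hw0 hB husc.
(* Extending [f] by [-1] off the closed annulus keeps it upper semicontinuous. *)
set (ann := fun w => r1 <= Cmod w <= r2).
set (g := fun x y => if excluded_middle_informative (ann (x, y)) then f (x, y) else -1).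
assert (hsq : forall x y, ann (x, y) -> - r2 <= x <= r2 /\ - r2 <= y <= r2).
{ intros x y [_ h]; generalize (Rmax_Cmod (x, y)); simpl; intros hm.
  generalize (Rmax_l (Rabs x) (Rabs y)) (Rmax_r (Rabs x) (Rabs y)); intros.
  split; apply Rabs_le_between; lra. }
assert (hr2 : 0 <= r2) by (generalize (Cmod_ge_0 w0); lra).
assert (hnear : forall u v d x y, Rabs (x - u) < d / 2 -> Rabs (y - v) < d / 2 ->
  exists h, Cmod h < d /\ (x, y) = ((u, v) + h)%C).
{ intros u v d x y hx hy; exists (x - u, y - v); split.
  - replace (x - u, y - v) with (RtoC (x - u) + Ci * RtoC (y - v))%C
      by (unfold Cplus, Cmult, Ci, RtoC; simpl; f_equal; ring).
    eapply Rle_lt_trans; [apply Cmod_triangle|].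
    rewrite Cmod_mult, Cmod_Ci, !Cmod_R; lra.
  - unfold Cplus; simpl; f_equal; ring. }
assert (hf0 : 0 <= B) by (generalize (hB w0 hw0); lra).
destruct (rectangle_max g (- r2) r2 (- r2) r2 B) as (u & v & hu & hv & H); try lra.
- intros x y _ _; unfold g; destruct (excluded_middle_informative _) as [h|h]; [|lra].
  apply (hB _ h).
- intros u v eta _ _ heta; unfold g at 2; destruct (excluded_middle_informative _) as [h|h].
  + destruct (husc _ eta h heta) as (d & hd & Hd).
    exists (d / 2); split; [lra|]; intros x y hx hy.
    unfold g; destruct (excluded_middle_informative _) as [h'|h'].
    * destruct (hnear _ _ _ _ _ hx hy) as (k & hk & ->); auto.
    * generalize (hB _ h); lra.
  + assert (hgap : exists d, 0 < d /\ forall k, Cmod k < d -> ~ ann ((u, v) + k)%C).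
    { assert (tri : forall k, Cmod ((u, v) + k) <= Cmod (u, v) + Cmod k /\
         Cmod (u, v) <= Cmod ((u, v) + k) + Cmod k).
      { intros k; split; [apply Cmod_triangle | apply Cmod_triangle_shift]. }
      destruct (Rlt_or_le (Cmod (u, v)) r1) as [h1|h1].
      - exists (r1 - Cmod (u, v)); split; [lra|]; intros k hk [h2 _].
        destruct (tri k); lra.
      - destruct (Rlt_or_le r2 (Cmod (u, v))) as [h2|h2]; [|exfalso; apply h; split; lra].
        exists (Cmod (u, v) - r2); split; [lra|]; intros k hk [_ h3].
        destruct (tri k); lra. }
    destruct hgap as (d & hd & Hd); exists (d / 2); split; [lra|]; intros x y hx hy.
    destruct (hnear _ _ _ _ _ hx hy) as (k & hk & e).
    unfold g; destruct (excluded_middle_informative _) as [h'|h']; [|lra].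
    exfalso; rewrite e in h'; now apply (Hd k hk).
- assert (hge : forall w, ann w -> f w <= g u v).
  { intros [x y] hw; generalize (H x y (proj1 (hsq x y hw)) (proj2 (hsq x y hw))).
    unfold g at 1; destruct (excluded_middle_informative _); tauto. }
  unfold g in hge; destruct (excluded_middle_informative _) as [h|h].
  + now exists (u, v).
  + exfalso; generalize (hge w0 hw0) (hB w0 hw0); lra.
Qed.

(** The term [delta |w|^2] forces the maximum of [|f|^2 + delta |w|^2] onto one of the two circles,
    by [no_interior_max]; then [delta] tends to 0. The bound [B] serves only the existence of that
    maximum, so it leaves no trace in the conclusion. *)
Lemma maximum_principle_annulus (f : C -> C) (r1 r2 B m : R) :
  (forall w, r1 <= Cmod w <= r2 -> second_order f w) ->
  (forall w, r1 <= Cmod w <= r2 -> Cmod (f w) <= B) ->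
  (forall w, Cmod w = r1 \/ Cmod w = r2 -> Cmod (f w) <= m) ->
  forall w, r1 <= Cmod w <= r2 -> Cmod (f w) <= m.
Proof.
intros hf hB hm w hw.
assert (hr : r1 <= r2) by lra.
assert (hr2 : 0 <= r2) by (generalize (Cmod_ge_0 w); lra).
assert (key : forall delta, 0 < delta ->
   Cmod (f w) ^ 2 <= Rmax m 0 ^ 2 + delta * r2 ^ 2).
{ intros delta hdelta.
  destruct (annulus_max (fun w => Cmod (f w) ^ 2 + delta * Cmod w ^ 2) r1 r2
    (B ^ 2 + delta * r2 ^ 2) w hw) as (w1 & hw1 & Hmax).
  - intros w1 hw1; specialize (hB w1 hw1).
    generalize (Cmod_ge_0 (f w1)) (Cmod_ge_0 w1); intros; split; [nra|].
    apply Rplus_le_compat; [nra|]; apply Rmult_le_compat_l; [lra | nra].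
  - intros w1 eta hw1 heta.
    destruct (bigO_nonneg _ _ (second_order_bounded _ _ (hf w1 hw1))) as (L & d & hL & hd & HL).
    set (A := Cmod (f w1)) in *; set (D := Cmod w1) in *.
    assert (hA : 0 <= A) by apply Cmod_ge_0.
    assert (hD : 0 <= D) by apply Cmod_ge_0.
    (* For [t <= 1], the linear rate [L] of [f] turns into the rate [Q] for
       [|f|^2 + delta |w|^2]. *)
    set (Q := 2 * A * L + L ^ 2 + delta * (2 * D + 1)).
    assert (hQ : 0 <= Q).
    { unfold Q; generalize (Rmult_le_pos _ _ hA hL); intros; nra. }
    assert (hp : 0 < eta / (Q + 1)) by (apply Rdiv_lt_0_compat; lra).
    exists (Rmin d (eta / (Q + 1))); split; [apply Rmin_glb_lt; lra|]; intros h hh.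
    assert (h1 : Cmod h < d) by (eapply Rlt_le_trans; [exact hh | apply Rmin_l]).
    assert (h2 : Cmod h < eta / (Q + 1)) by (eapply Rlt_le_trans; [exact hh | apply Rmin_r]).
    apply (Rmult_lt_compat_r (Q + 1)) in h2; [|lra].
    replace (eta / (Q + 1) * (Q + 1)) with eta in h2 by (field; lra).
    specialize (HL h h1); simpl in HL; rewrite Rmult_1_r in HL.
    assert (t0 := Cmod_ge_0 h); set (t := Cmod h) in *.
    assert (b1 : Cmod (f (w1 + h)%C) <= A + L * t).
    { generalize (Cmod_triangle (f (w1 + h)%C - f w1) (f w1)).
      replace (f (w1 + h)%C - f w1 + f w1)%C with (f (w1 + h)%C) by ring.
      unfold A; lra. }
    assert (b2 : Cmod (w1 + h) <= D + t) by apply Cmod_triangle.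
    assert (c1 : Cmod (f (w1 + h)%C) ^ 2 <= (A + L * t) ^ 2)
      by (apply pow_incr; split; [apply Cmod_ge_0 | exact b1]).
    assert (c2 : Cmod (w1 + h) ^ 2 <= (D + t) ^ 2)
      by (apply pow_incr; split; [apply Cmod_ge_0 | exact b2]).
    apply (Rmult_le_compat_l delta) in c2; [|lra].
    assert (ht2 : t ^ 2 <= t) by nra.
    assert (L ^ 2 * t ^ 2 <= L ^ 2 * t) by (apply Rmult_le_compat_l; [apply pow2_ge_0 | exact ht2]).
    assert (delta * t ^ 2 <= delta * t) by (apply Rmult_le_compat_l; lra).
    assert ((A + L * t) ^ 2 + delta * (D + t) ^ 2 <= A ^ 2 + delta * D ^ 2 + Q * t).
    { unfold Q; lra. }
    nra.
  - assert (hbd : Cmod w1 = r1 \/ Cmod w1 = r2).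
    { apply NNPP; intros hn.
      assert (hin : r1 < Cmod w1 < r2) by (split; apply Rnot_le_lt; intros ?; apply hn; lra).
      apply (no_interior_max f w1 delta (Rmin (Cmod w1 - r1) (r2 - Cmod w1))); auto.
      - apply Rmin_glb_lt; lra.
      - intros h hh; apply Hmax.
        assert (h1 : Cmod h < Cmod w1 - r1) by (eapply Rlt_le_trans; [exact hh | apply Rmin_l]).
        assert (h2 : Cmod h < r2 - Cmod w1) by (eapply Rlt_le_trans; [exact hh | apply Rmin_r]).
        generalize (Cmod_triangle w1 h) (Cmod_triangle_shift w1 h); lra. }
    specialize (Hmax w hw); specialize (hm w1 hbd).
    assert (Cmod (f w1) ^ 2 <= Rmax m 0 ^ 2).
    { apply pow_incr; split; [apply Cmod_ge_0|]; generalize (Rmax_l m 0); lra. }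
    assert (Cmod w1 ^ 2 <= r2 ^ 2) by (apply pow_incr; split; [apply Cmod_ge_0 | lra]).
    assert (0 <= delta * Cmod w ^ 2) by (apply Rmult_le_pos; [lra | apply pow2_ge_0]).
    nra. }
assert (hsq : Cmod (f w) ^ 2 <= Rmax m 0 ^ 2).
{ apply le_epsilon; intros eps heps.
  assert (hp : 0 < r2 ^ 2 + 1) by nra.
  eapply Rle_trans; [apply (key (eps / (r2 ^ 2 + 1))); apply Rdiv_lt_0_compat; lra|].
  apply Rplus_le_compat_l.
  apply (Rmult_le_reg_r (r2 ^ 2 + 1)); [lra|]; field_simplify; nra. }
assert (hmax : Cmod (f w) <= Rmax m 0).
{ generalize (Cmod_ge_0 (f w)) (Rmax_r m 0); intros; nra. }
(* [m] carries no sign in the hypotheses, hence [Rmax m 0] in the squares above; the boundary bound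
   at the real point [r2] removes it. *)
assert (hm0 : 0 <= m).
{ assert (e : Cmod (RtoC r2) = r2) by (rewrite Cmod_R; now apply Rabs_pos_eq).
  generalize (hm (RtoC r2) ltac:(now right)) (Cmod_ge_0 (f (RtoC r2))); lra. }
rewrite Rmax_left in hmax; lra.
Qed.

(** * Bounded analytic functions on the ellipse *)

Notation C_is_series := (is_series (K := C_AbsRing) (V := C_NormedModule)).
Notation C_ex_series := (ex_series (K := C_AbsRing) (V := C_NormedModule)).

Lemma pow_n_Cpow (x : C) (k : nat) : pow_n (K := C_AbsRing) x k = (x ^ k)%C.
Proof. induction k as [|k IH]; simpl; [reflexivity | now rewrite IH]. Qed.

(** Reduces every estimate of a series below to finite sums of real numbers, to which
    [sum_geom_bound] and [damped_geom_sum_bound] apply. *)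
Lemma C_is_series_bound (a : nat -> C) (l : C) (B : R) :
  C_is_series a l -> (forall n, sum_f_R0 (fun k => Cmod (a k)) n <= B) -> Cmod l <= B.
Proof.
intros Ha HB.
assert (H : is_lim_seq (fun n => norm (sum_n a n)) (norm (l : C_NormedModule))).
{ eapply filterlim_comp; [exact Ha | apply (filterlim_norm (K := C_AbsRing) (V := C_NormedModule))]. }
assert (H' : Rbar_le (norm (l : C_NormedModule)) B).
{ apply (is_lim_seq_le (fun n => norm (sum_n a n)) (fun _ => B)); [|exact H|apply is_lim_seq_const].
  intros n; eapply Rle_trans; [|apply (HB n)].
  rewrite <- sum_n_Reals; apply (norm_sum_n_m (K := C_AbsRing) (V := C_NormedModule)). }
exact H'.
Qed.

Lemma sum_geom_bound (a : nat -> R) (B q : R) (n : nat) : 0 <= B -> 0 <= q < 1 ->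
  (forall k, a k <= B * q ^ k) -> sum_f_R0 a n <= B / (1 - q).
Proof.
intros hB hq ha.
apply Rle_trans with (B * (1 - q ^ S n) / (1 - q)).
- induction n as [|n IH]; simpl sum_f_R0.
  + generalize (ha 0%nat); simpl; intros; field_simplify; lra.
  + apply Rle_trans with (1 := Rplus_le_compat _ _ _ _ IH (ha (S n))).
    right; simpl; field; lra.
- unfold Rdiv; apply Rmult_le_compat_r; [left; apply Rinv_0_lt_compat; lra|].
  assert (0 <= q ^ S n) by (apply pow_le; lra); nra.
Qed.

Lemma C_is_series_tail (a : nat -> C) (l : C) (B q : R) (N : nat) :
  0 <= B -> 0 <= q < 1 -> C_is_series a l -> (forall k, Cmod (a k) <= B * q ^ k) ->
  Cmod (l - sum_n (G := C_AbelianMonoid) a N) <= B * q ^ S N / (1 - q).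
Proof.
intros hB hq Ha hb.
apply (C_is_series_bound (fun k => a (S N + k)%nat)).
- apply (is_series_incr_n (K := C_AbsRing) (V := C_NormedModule) a (S N)); [lia|].
  simpl pred.
  refine (eq_ind_r (C_is_series a) Ha _).
  change (l - sum_n (G := C_AbelianMonoid) a N + sum_n (G := C_AbelianMonoid) a N = l)%C; ring.
- intros n; apply sum_geom_bound; [|exact hq|].
  + apply Rmult_le_pos; [lra | apply pow_le; lra].
  + intros k; rewrite Rmult_assoc, <- pow_add; apply hb.
Qed.

Lemma C_is_series_terms_bounded (a : nat -> C) (l : C) :
  C_is_series a l -> exists B, 0 <= B /\ forall k, Cmod (a k) <= B.
Proof.
intros Ha; destruct (filterlim_bounded _ (ex_intro _ _ Ha)) as [B HB].
change (forall n, Cmod (sum_n (G := C_AbelianMonoid) a n) <= B) in HB.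
assert (hB : 0 <= B) by (eapply Rle_trans; [apply Cmod_ge_0 | apply (HB 0%nat)]).
exists (B + B); split; [lra|]; intros [|k].
- generalize (HB 0%nat); rewrite sum_O; lra.
- generalize (HB (S k)) (HB k) (Cmod_triangle_minus (sum_n (G := C_AbelianMonoid) a (S k))
    (sum_n (G := C_AbelianMonoid) a k)).
  rewrite sum_Sn.
  change (plus (sum_n (G := C_AbelianMonoid) a k) (a (S k)))
    with (sum_n (G := C_AbelianMonoid) a k + a (S k))%C.
  replace (sum_n (G := C_AbelianMonoid) a k + a (S k) - sum_n (G := C_AbelianMonoid) a k)%C
    with (a (S k)) by ring.
  lra.
Qed.

Lemma C_ex_series_geom (a : nat -> C) (B q : R) :
  0 <= q < 1 -> (forall k, Cmod (a k) <= B * q ^ k) -> C_ex_series a.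
Proof.
intros hq hb.
apply (ex_series_le (K := C_AbsRing) (V := C_CompleteNormedModule) a (fun k => B * q ^ k)).
- exact hb.
- apply (ex_series_scal (K := R_AbsRing) (V := R_NormedModule) B), ex_series_geom.
  rewrite Rabs_pos_eq; lra.
Qed.

(** Convergence at one point of modulus [r / 2] bounds the coefficients geometrically; the tail
    after the quadratic term is then a geometric series of size [|h|^3]. *)
Lemma analytic_second_order (D : C -> Prop) (f : C -> C) (z : C) :
  analytic_on D f -> D z -> second_order f z.
Proof.
intros hf hz; destruct (hf z hz) as (r & a & hr & H).
set (rho := r / 2).
assert (hrho : 0 < rho) by (unfold rho; lra).
assert (hb : exists B, 0 <= B /\ forall k, Cmod (a k) <= B * (/ rho) ^ k).
{ assert (hm : Cmod (RtoC rho) = rho) by (rewrite Cmod_R; apply Rabs_pos_eq; lra).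
  assert (Hs := H (RtoC rho) ltac:(rewrite hm; unfold rho; lra)).
  destruct (C_is_series_terms_bounded _ _ Hs) as (B & hB & HB).
  exists B; split; [exact hB|].
  intros k; specialize (HB k); rewrite pow_n_Cpow in HB.
    change (Cmod (RtoC rho ^ k * a k) <= B) in HB.
    rewrite Cmod_mult, Cmod_pow, hm in HB.
    assert (hp : 0 < rho ^ k) by now apply pow_lt.
    rewrite pow_inv.
    apply (Rmult_le_reg_l (rho ^ k)); [exact hp|].
    replace (rho ^ k * (B * / rho ^ k)) with B by (field; lra); exact HB. }
destruct hb as (B & hB & hb).
assert (key : forall h, Cmod h < rho / 2 ->
   Cmod (f (z + h)%C - (a 0%nat + a 1%nat * h + a 2%nat * (h * h)))
     <= 2 * B * (/ rho) ^ 3 * Cmod h ^ 3).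
{ intros h hh; assert (h0 := Cmod_ge_0 h).
  set (q := Cmod h * / rho).
  assert (hq : 0 <= q <= / 2).
  { assert (0 < / rho) by now apply Rinv_0_lt_compat.
    unfold q; split; [nra|]; apply (Rmult_le_reg_r rho); [lra|].
    rewrite Rmult_assoc, Rinv_l by lra; lra. }
  generalize (C_is_series_tail _ _ B q 2 hB ltac:(lra) (H h ltac:(unfold rho in hh; lra))).
  intros T; eapply Rle_trans; [eapply Rle_trans; [|apply T]|].
  - right; apply f_equal; rewrite !sum_Sn, sum_O; unfold plus, scal; simpl.
    unfold mult, one; simpl; ring.
  - intros k; rewrite pow_n_Cpow.
    change (Cmod (h ^ k * a k) <= B * q ^ k).
    rewrite Cmod_mult, Cmod_pow; unfold q; rewrite Rpow_mult_distr.
    specialize (hb k); assert (0 <= Cmod h ^ k) by now apply pow_le.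
    nra.
  - apply Rle_trans with (B * q ^ 3 * 2).
    + unfold Rdiv; apply Rmult_le_compat_l.
      * apply Rmult_le_pos; [lra | apply pow_le; lra].
      * rewrite <- (Rinv_inv 2); apply Rinv_le_contravar; lra.
    + right; unfold q; rewrite Rpow_mult_distr; ring. }
(* The estimate at [h = 0] has a vanishing right-hand side, which identifies the constant
   coefficient. *)
assert (hfz : f z = a 0%nat).
{ assert (k0 := key 0%C); rewrite Cmod_0 in k0; specialize (k0 ltac:(lra)).
  replace (z + 0)%C with z in k0 by ring.
  replace (f z - (a 0%nat + a 1%nat * 0 + a 2%nat * (0 * 0)))%C with (f z - a 0%nat)%C in k0 by ring.
  replace (2 * B * (/ rho) ^ 3 * 0 ^ 3) with 0 in k0 by ring.
  assert (e : (f z - a 0%nat)%C = 0) by (apply Cmod_eq_0, Rle_antisym; [exact k0 | apply Cmod_ge_0]).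
  replace (f z) with (f z - a 0%nat + a 0%nat)%C by ring; rewrite e; ring. }
exists (a 1%nat), (a 2%nat), (2 * B * (/ rho) ^ 3), (rho / 2); split; [lra|].
intros h hh; rewrite hfz; now apply key.
Qed.

(** * Essential supremum versus pointwise bounds *)

Lemma interval_not_null (A : R -> Prop) (p q : R) :
  p < q -> (forall x, p <= x <= q -> A x) -> ~ Lebesgue_null A.
Proof.
intros hpq hA hnull.
destruct (hnull ((q - p) / 2) ltac:(lra)) as (l & r & hlr & hcov & hsum).
(* Length of the part of the [n]-th interval lying to the left of [x]; differences of [t] measure
   the part inside a given interval. *)
set (t := fun n x => Rmin (r n) x - Rmin (l n) x).
assert (tmono : forall n x y, x <= y -> t n x <= t n y).
{ intros n x y hxy; unfold t; specialize (hlr n); unfold Rmin.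
  repeat destruct Rle_dec; lra. }
assert (t0 : forall n x, 0 <= t n x <= r n - l n).
{ intros n x; unfold t; specialize (hlr n); unfold Rmin; repeat destruct Rle_dec; lra. }
set (phi := fun N x => sum_f_R0 (fun n => t n x) N).
assert (incr : forall N x y, x <= y ->
  forall N', (N <= N')%nat -> phi N y - phi N x <= phi N' y - phi N' x).
{ intros N x y hxy N' hN; induction hN as [|N' hN IH]; [lra|].
  unfold phi in *; simpl; generalize (tmono (S N') x y hxy); lra. }
assert (one : forall m N x y, x <= y -> (m <= N)%nat -> t m y - t m x <= phi N y - phi N x).
{ intros m N x y hxy hmN; apply Rle_trans with (phi m y - phi m x); [|now apply incr].
  destruct m as [|m]; [unfold phi; simpl; lra|].
  generalize (incr 0%nat x y hxy m ltac:(lia)) (tmono 0%nat x y hxy); unfold phi; simpl; lra. }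
(* Points up to which finitely many intervals already account for the length of [[p, x]]. The
   supremum of this set is pushed to [q], so no finite subcover has to be extracted and ordered. *)
set (S := fun x => p <= x <= q /\ exists N, x - p <= phi N x - phi N p).
assert (step : forall x y m, S x -> x <= y <= q -> l m < x -> y < r m -> S y).
{ intros x y m [hx [N hN]] hy h1 h2; split; [lra|]; exists (max N m).
  generalize (incr N p x ltac:(lra) (max N m) ltac:(lia))
             (one m (max N m) x y ltac:(lra) ltac:(lia)).
  unfold t, Rmin; repeat destruct Rle_dec; lra. }
assert (Sp : S p) by (split; [lra|]; exists 0%nat; lra).
destruct (completeness S) as [s [hs1 hs2]].
{ exists q; intros x [hx _]; lra. }
{ now exists p. }
assert (hps : p <= s) by now apply hs1.
assert (hsq : s <= q) by (apply hs2; intros x [hx _]; lra).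
destruct (hcov s (hA s ltac:(lra))) as [m [hm1 hm2]].
assert (hx : exists x, S x /\ l m < x <= s).
{ apply NNPP; intros hn; assert (s <= l m); [|lra].
  apply hs2; intros x hx; apply Rnot_lt_le; intros hlt; apply hn; exists x; split; [exact hx|].
  split; [exact hlt | now apply hs1]. }
destruct hx as (x & hSx & hx1 & hx2).
(* A point still inside the interval that covers [s], and beyond [s] unless [s = q]; membership in
   [S] therefore forces [y = q]. *)
set (y := Rmin q ((s + r m) / 2)).
assert (hy : s <= y <= q /\ y < r m).
{ unfold y, Rmin; destruct Rle_dec; lra. }
assert (hSy : S y) by (apply (step x y m); auto; lra).
assert (hyq : y = q).
{ generalize (hs1 y hSy); unfold y, Rmin; destruct Rle_dec; lra. }
rewrite hyq in hSy; destruct hSy as [_ [N hN]].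
assert (phi N q - phi N p <= sum_f_R0 (fun n => r n - l n) N).
{ apply Rle_trans with (phi N q).
  - assert (0 <= phi N p) by (apply cond_pos_sum; intros; apply t0); lra.
  - apply sum_Rle; intros; apply t0. }
generalize (hsum N); lra.
Qed.

(** Lower semicontinuity of [|f|] spreads a value above [c] to a whole interval, which is not null.
    The closed interval is reached because nearby points on one side suffice. *)
Lemma Linf_norm_pointwise (a b c : R) (f : R -> C) : a < b ->
  (forall x eta, a <= x <= b -> 0 < eta ->
     exists d, 0 < d /\ forall y, Rabs (y - x) < d -> Cmod (f x) < Cmod (f y) + eta) ->
  Rbar_le (Linf_norm a b f) c -> forall x, a <= x <= b -> Cmod (f x) <= c.
Proof.
intros hab hcont hle x hx; apply Rnot_lt_le; intros hgt.
set (c0 := (c + Cmod (f x)) / 2).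
destruct (Glb_Rbar_correct (fun c => 0 <= c /\ Lebesgue_null (fun x => a < x < b /\ c < Cmod (f x))))
  as [_ Hglb].
assert (hn : ~ Rbar_le c0 (Linf_norm a b f)).
{ intros h; generalize (Rbar_le_trans _ _ _ h hle); simpl; unfold c0; lra. }
apply hn, Hglb; intros k [hk hnull]; simpl.
apply Rnot_lt_le; intros hk0.
destruct (hcont x (Cmod (f x) - c0) hx ltac:(unfold c0; lra)) as (d & hd & Hd).
(* Clamping by a quarter of [Rmin d (b - a)] keeps [[p, q]] inside the open interval and
   nondegenerate even when [x] is an endpoint. *)
set (p := Rmax (x - d / 2) (a + Rmin d (b - a) / 4)).
set (q := Rmin (x + d / 2) (b - Rmin d (b - a) / 4)).
apply (interval_not_null _ p q) in hnull; [exact hnull| |].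
- unfold p, q, Rmax, Rmin; repeat destruct Rle_dec; lra.
- intros y hy.
  assert (hy' : a < y < b /\ Rabs (y - x) < d).
  { assert (p1 : x - d / 2 <= p) by apply Rmax_l.
    assert (p2 : a + Rmin d (b - a) / 4 <= p) by apply Rmax_r.
    assert (q1 : q <= x + d / 2) by apply Rmin_l.
    assert (q2 : q <= b - Rmin d (b - a) / 4) by apply Rmin_r.
    assert (0 < Rmin d (b - a)) by (apply Rmin_glb_lt; lra).
    split; [lra|]; apply Rabs_lt_between; lra. }
  split; [tauto|]; generalize (Hd y (proj2 hy')); lra.
Qed.

Lemma Linf_norm_le (a b c : R) (f : R -> C) : 0 <= c ->
  (forall x, a <= x <= b -> Cmod (f x) <= c) -> Rbar_le (Linf_norm a b f) c.
Proof.
intros hc H.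
destruct (Glb_Rbar_correct (fun c => 0 <= c /\ Lebesgue_null (fun x => a < x < b /\ c < Cmod (f x))))
  as [Hlb _].
apply Hlb; split; [exact hc|]; intros eta heta.
exists (fun _ => 0), (fun _ => 0); split; [|split].
- intros; lra.
- intros x [hx hlt]; generalize (H x ltac:(lra)); lra.
- intros N; rewrite (sum_eq _ (fun _ => 0)) by (intros; ring).
  rewrite sum_cte; lra.
Qed.

Lemma Hinf_norm_pointwise (D : C -> Prop) (f : C -> C) (c : R) :
  Rbar_le (Hinf_norm D f) c -> forall z, D z -> Cmod (f z) <= c.
Proof.
intros H z hz.
destruct (Lub_Rbar_correct (fun r => exists z : C, D z /\ r = Cmod (f z))) as [Hub _].
apply (Rbar_le_trans _ _ c (Hub (Cmod (f z)) (ex_intro _ z (conj hz eq_refl))) H).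
Qed.

Lemma Hinf_norm_le (D : C -> Prop) (f : C -> C) (c : R) :
  (forall z, D z -> Cmod (f z) <= c) -> Rbar_le (Hinf_norm D f) c.
Proof.
intros H.
destruct (Lub_Rbar_correct (fun r => exists z : C, D z /\ r = Cmod (f z))) as [_ Hlub].
apply Hlub; intros r (z & hz & ->); now apply H.
Qed.

(** * The upper bound by three circles *)

Lemma joukowski_circle (w : C) : Cmod w = 1 -> joukowski w = RtoC (Re w) /\ -1 <= Re w <= 1.
Proof.
intros hw.
assert (hm : Re w ^ 2 + Im w ^ 2 = 1) by (rewrite <- Cmod2_alt, hw; ring).
assert (hc : (w * Cconj w)%C = 1).
{ rewrite <- Cmod2_conj, hw; f_equal; ring. }
split.
- unfold joukowski; rewrite <- (Cinv_unique _ _ hc), re_alt; reflexivity.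
- split; nra.
Qed.

Lemma bernoulli_lower (x : R) (n : nat) : 0 <= x <= 1 -> 1 - INR n * x <= (1 - x) ^ n.
Proof.
intros hx; induction n as [|n IH]; [simpl; lra|].
rewrite S_INR; simpl.
assert (0 <= INR n) by apply pos_INR.
assert (0 <= INR n * x * x) by (repeat apply Rmult_le_pos; lra).
apply Rle_trans with ((1 - x) * (1 - INR n * x)); [lra|].
apply Rmult_le_compat_l; lra.
Qed.

(** Hadamard's three-circle argument, with an integer exponent so that
    [F (joukowski w) * w ^ (-n)] is single valued. The factor [2] comes from
    replacing [rho] by some [r < rho] with [(rho / r) ^ n <= 2], as [F] need not
    extend to the boundary. *)
Lemma three_circles (rho eps : R) (F : C -> C) (n : nat) (w : C) :
  1 < rho -> analytic_on (bernstein_ellipse rho) F ->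
  (forall zeta, bernstein_ellipse rho zeta -> Cmod (F zeta) <= 1) ->
  (forall x, -1 <= x <= 1 -> Cmod (F (RtoC x)) <= eps) ->
  eps * rho ^ n <= 1 -> 1 < Cmod w < rho ->
  Cmod (F (joukowski w)) <= 2 * (Cmod w / rho) ^ n.
Proof.
intros hrho hF hF1 hFeps hn hw.
assert (hn0 : 0 <= INR n) by apply pos_INR.
(* The first entry gives [(1 - x)^n >= 1/2] by Bernoulli's inequality, the second gives [|w| <= r]
   for [r = rho (1 - x)]. *)
set (x := Rmin (/ (2 * (INR n + 1))) ((rho - Cmod w) / rho)).
assert (hx0 : 0 < x).
{ unfold x; apply Rmin_glb_lt; [apply Rinv_0_lt_compat; lra | apply Rdiv_lt_0_compat; lra]. }
assert (hx1 : INR n * x <= / 2).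
{ apply Rle_trans with (INR n * / (2 * (INR n + 1))).
  - apply Rmult_le_compat_l; [exact hn0 | apply Rmin_l].
  - apply (Rmult_le_reg_r (2 * (INR n + 1))); [lra|]; field_simplify; lra. }
assert (hx2 : x * rho <= rho - Cmod w).
{ apply Rle_trans with ((rho - Cmod w) / rho * rho).
  - apply Rmult_le_compat_r; [lra | apply Rmin_r].
  - right; field; lra. }
set (r := rho * (1 - x)).
assert (hr : Cmod w <= r) by (unfold r; lra).
assert (hr' : r < rho) by (unfold r; nra).
assert (hx3 : x < 1) by (assert (0 < 1 - x); [|lra]; unfold r in hr; nra).
assert (hp : 0 < rho ^ n) by (apply pow_lt; lra).
assert (hrn : / r ^ n <= 2 * / rho ^ n).
{ unfold r; rewrite Rpow_mult_distr, Rinv_mult.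
  assert (hb := bernoulli_lower x n ltac:(lra)).
  assert (/ (1 - x) ^ n <= 2) by (rewrite <- (Rinv_inv 2); apply Rinv_le_contravar; lra).
  assert (0 < / rho ^ n) by now apply Rinv_0_lt_compat.
  nra. }
assert (H : Cmod (F (joukowski w) * (/ w) ^ n) <= 2 * / rho ^ n).
{ apply (maximum_principle_annulus (fun w => F (joukowski w) * (/ w) ^ n)%C 1 r 1); [| | |lra].
  - intros u hu; assert (hu0 : u <> 0) by (apply Cneq_0_of_Cmod; lra).
    apply (second_order_mult (fun w => F (joukowski w)) (fun w => (/ w) ^ n)%C).
    + apply second_order_comp; [now apply second_order_joukowski|].
      apply (analytic_second_order _ _ _ hF), bernstein_joukowski; lra.
    + apply second_order_pow; now apply second_order_inv.
  - intros u hu; assert (hu0 : u <> 0) by (apply Cneq_0_of_Cmod; lra).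
    rewrite Cmod_mult, Cmod_pow, Cmod_inv by exact hu0.
    assert (h1 : Cmod (F (joukowski u)) <= 1) by (apply hF1, bernstein_joukowski; lra).
    assert (h2 : 0 < / Cmod u <= 1).
    { split; [apply Rinv_0_lt_compat; lra|]; rewrite <- Rinv_1; apply Rinv_le_contravar; lra. }
    assert (h3 : (/ Cmod u) ^ n <= 1) by (rewrite <- (pow1 n); apply pow_incr; lra).
    assert (h4 : 0 <= (/ Cmod u) ^ n) by (apply pow_le; lra).
    generalize (Cmod_ge_0 (F (joukowski u))); nra.
  (* Both circles yield the same bound: [eps <= rho^(-n)] on the inner one, which [joukowski] folds
     onto the segment, and [r^(-n) <= 2 rho^(-n)] on the outer one. *)
  - intros u hu; assert (hu1 : 1 <= Cmod u) by lra.
    assert (hu0 : u <> 0) by (apply Cneq_0_of_Cmod; lra).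
    rewrite Cmod_mult, Cmod_pow, Cmod_inv by exact hu0.
    destruct hu as [hu|hu]; rewrite hu.
    + destruct (joukowski_circle u hu) as [-> hre].
      rewrite Rinv_1, pow1, Rmult_1_r.
      apply Rle_trans with (1 := hFeps _ hre).
      apply (Rmult_le_reg_r (rho ^ n)); [exact hp|]; field_simplify; lra.
    + rewrite pow_inv.
      assert (h1 : Cmod (F (joukowski u)) <= 1) by (apply hF1, bernstein_joukowski; lra).
      assert (0 < / r ^ n) by (apply Rinv_0_lt_compat, pow_lt; lra).
      nra. }
assert (hw0 : w <> 0) by (apply Cneq_0_of_Cmod; lra).
rewrite Cmod_mult, Cmod_pow, Cmod_inv, pow_inv in H by exact hw0.
assert (hwn : 0 < Cmod w ^ n) by (apply pow_lt; lra).
apply (Rmult_le_compat_r (Cmod w ^ n)) in H; [|lra].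
rewrite Rmult_assoc, Rinv_l, Rmult_1_r in H by lra.
unfold Rdiv; rewrite Rpow_mult_distr, pow_inv; lra.
Qed.

(** * The optimal function *)

Lemma CSeries_correct (a : nat -> C) : C_ex_series a -> C_is_series a (CSeries a).
Proof. intros [l Hl]; now rewrite (is_series_CSeries a l Hl). Qed.

Lemma C_is_series_scal (c : C) (a : nat -> C) (l : C) :
  C_is_series a l -> C_is_series (fun n => c * a n)%C (c * l)%C.
Proof. apply (is_series_scal (K := C_AbsRing) (V := C_NormedModule) c a l). Qed.

Lemma C_is_series_minus (a b : nat -> C) (la lb : C) :
  C_is_series a la -> C_is_series b lb -> C_is_series (fun n => a n - b n)%C (la - lb)%C.
Proof. apply (is_series_minus (K := C_AbsRing) (V := C_NormedModule) a b la lb). Qed.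

(** Coefficients of [T_n (z + h)] in powers of [h]. The factor [2 (z + h)] of the Chebyshev
    recursion splits into multiplication by [2 z] and, through [2 h], a shift of the
    coefficients. *)
Fixpoint chebT_taylor (z : C) (n : nat) : nat -> C :=
  match n with
  | O => fun k => match k with O => 1%C | S _ => 0%C end
  | S m => match m with
           | O => fun k => match k with O => z | S O => 1%C | S (S _) => 0%C end
           | S j => fun k =>
               (2 * z * chebT_taylor z m k
                + 2 * match k with O => 0 | S i => chebT_taylor z m i end
                - chebT_taylor z j k)%C
           end
  end.

Notation C_is_pseries := (is_pseries (K := C_AbsRing) (V := C_NormedModule)).

Lemma C_is_pseries_ext (a b : nat -> C) (h l l' : C) :
  (forall k, a k = b k) -> l = l' -> C_is_pseries a h l -> C_is_pseries b h l'.
Proof.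
intros hab <-; apply is_series_ext; intros k; now rewrite hab.
Qed.

Lemma C_is_pseries_one (h : C) :
  C_is_pseries (fun k => match k with O => RtoC 1 | S _ => RtoC 0 end) h (RtoC 1).
Proof.
unfold is_pseries, is_series.
apply (filterlim_ext (fun _ => RtoC 1)); [|apply filterlim_const].
intros n; symmetry; induction n as [|n IH].
- rewrite sum_O; unfold scal; simpl; unfold mult, one; simpl; ring.
- rewrite sum_Sn, IH; unfold plus, scal; simpl; unfold mult; simpl; ring.
Qed.

Lemma chebT_taylor_correct (z h : C) (n : nat) :
  C_is_pseries (chebT_taylor z n) h (chebT n (z + h)%C).
Proof.
enough (H : C_is_pseries (chebT_taylor z n) h (chebT n (z + h)%C) /\
            C_is_pseries (chebT_taylor z (S n)) h (chebT (S n) (z + h)%C)) by apply H.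
induction n as [|n [IH1 IH2]].
- split; [apply C_is_pseries_one|].
  assert (H1 := is_pseries_scal z _ h _ (Cmult_comm _ _) (C_is_pseries_one h)).
  assert (H2 := is_pseries_incr_1 _ h _ (C_is_pseries_one h)).
  generalize (is_pseries_plus _ _ _ _ _ H1 H2); apply C_is_pseries_ext.
  + intros [|[|k]]; unfold PS_plus, PS_scal, PS_incr_1, plus, scal, zero; simpl;
      unfold mult; simpl; ring.
  + unfold plus, scal; simpl; unfold mult; simpl; ring.
- split; [exact IH2|].
  assert (H1 := is_pseries_scal (2 * z)%C _ h _ (Cmult_comm _ _) IH2).
  assert (H2 := is_pseries_scal (RtoC 2) _ h _ (Cmult_comm _ _) (is_pseries_incr_1 _ h _ IH2)).
  generalize (is_pseries_minus _ _ _ _ _ (is_pseries_plus _ _ _ _ _ H1 H2) IH1).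
  apply C_is_pseries_ext.
  + intros [|k]; reflexivity.
  + change (2 * z * chebT (S n) (z + h)%C + 2 * (h * chebT (S n) (z + h)%C) - chebT n (z + h)%C
      = 2 * (z + h) * chebT (S n) (z + h)%C - chebT n (z + h)%C)%C; ring.
Qed.

(** The differences [t (n+1) - w t n] of Taylor coefficients satisfy a first-order
    recursion with contraction factor [/ w], which avoids the loss of a naive
    majorant of the three-term recursion. *)
Lemma chebT_taylor_bound (rho : R) (w : C) (n k : nat) :
  1 < rho -> 1 <= Cmod w < rho ->
  let d := (rho - Cmod w) * (rho - 1) / (2 * rho) in
  Cmod (chebT_taylor (joukowski w) n k) * d ^ k
    <= (rho + d) / (rho - Cmod w) * rho ^ n.
Proof.
intros hrho hw d.
assert (hd : 0 < d) by (unfold d; apply Rdiv_lt_0_compat; nra).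
assert (hd2 : 2 * d * rho = (rho - Cmod w) * (rho - 1)) by (unfold d; field; lra).
set (B := (rho + d) / (rho - Cmod w)).
assert (hB : (rho - Cmod w) * B = rho + d) by (unfold B; field; lra).
assert (hB1 : 1 <= B) by nra.
set (z := joukowski w).
assert (hw0 : w <> 0) by (apply Cneq_0_of_Cmod; lra).
clearbody d B.
enough (H : forall k, Cmod (chebT_taylor z n k) * d ^ k <= B * rho ^ n /\
   Cmod (chebT_taylor z (S n) k - w * chebT_taylor z n k) * d ^ k
     <= (rho + d) * rho ^ n) by apply H.
clear k; induction n as [|n IH]; intros k.
- destruct k as [|[|k]].
  + simpl; rewrite Cmod_1; split; [lra|].
    replace (z - w * 1)%C with ((/ w - w) / 2)%C
      by (unfold z, joukowski; field; exact hw0).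
    rewrite Cmod_div, Cmod_two by apply Ctwo_neq_0.
    generalize (Cmod_triangle_minus (/ w) w); rewrite Cmod_inv by exact hw0.
    assert (/ Cmod w <= 1) by (rewrite <- Rinv_1; apply Rinv_le_contravar; lra).
    lra.
  + simpl; rewrite Cmod_0; split; [lra|].
    replace (1 - w * 0)%C with (RtoC 1) by ring; rewrite Cmod_1; lra.
  + simpl; rewrite Cmod_0; split; [lra|].
    replace (0 - w * 0)%C with (RtoC 0) by ring; rewrite Cmod_0; nra.
- assert (hr : 0 < rho ^ n) by (apply pow_lt; lra).
  assert (ht : forall i, Cmod (chebT_taylor z (S n) i) * d ^ i <= B * rho ^ S n).
  { intros i; destruct (IH i) as [h1 h2].
    assert (hdi : 0 < d ^ i) by now apply pow_lt.
    generalize (Cmod_triangle (chebT_taylor z (S n) i - w * chebT_taylor z n i)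
                              (w * chebT_taylor z n i)).
    replace (chebT_taylor z (S n) i - w * chebT_taylor z n i + w * chebT_taylor z n i)%C
      with (chebT_taylor z (S n) i) by ring.
    rewrite Cmod_mult; intros h3.
    apply (Rmult_le_compat_r (d ^ i)) in h3; [|lra].
    apply (Rmult_le_compat_l (Cmod w)) in h1; [|lra].
    rewrite <- hB in h2; rewrite <- (tech_pow_Rmult rho n); lra. }
  split; [apply ht|].
  assert (e : (chebT_taylor z (S (S n)) k - w * chebT_taylor z (S n) k
     = (chebT_taylor z (S n) k - w * chebT_taylor z n k) * / w
       + 2 * match k with O => 0 | S i => chebT_taylor z (S n) i end)%C).
  { change (chebT_taylor z (S (S n)) k) with
      (2 * z * chebT_taylor z (S n) k
        + 2 * match k with O => 0 | S i => chebT_taylor z (S n) i end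
        - chebT_taylor z n k)%C.
    replace (2 * z)%C with (w + / w)%C by (unfold z, joukowski; field; exact hw0).
    field; exact hw0. }
  rewrite e.
  assert (hdk : 0 < d ^ k) by now apply pow_lt.
  assert (h4 : Cmod (2 * match k with O => 0 | S i => chebT_taylor z (S n) i end) * d ^ k
     <= 2 * d * (B * rho ^ S n)).
  { destruct k as [|i].
    - rewrite Cmult_0_r, Cmod_0, Rmult_0_l.
      assert (hr' : 0 < rho ^ S n) by (apply pow_lt; lra).
      apply Rmult_le_pos; [lra|]; apply Rmult_le_pos; lra.
    - rewrite Cmod_mult, Cmod_two, <- (tech_pow_Rmult d i).
      replace (2 * Cmod (chebT_taylor z (S n) i) * (d * d ^ i))
        with (2 * d * (Cmod (chebT_taylor z (S n) i) * d ^ i)) by ring.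
      apply Rmult_le_compat_l; [lra | apply ht]. }
  destruct (IH k) as [_ h2].
  eapply Rle_trans; [apply Rmult_le_compat_r; [lra | apply Cmod_triangle]|].
  rewrite Cmod_mult, Cmod_inv by exact hw0.
  assert (h5 : 0 < / Cmod w <= 1).
  { split; [apply Rinv_0_lt_compat; lra|]; rewrite <- Rinv_1; apply Rinv_le_contravar; lra. }
  set (E := Cmod (chebT_taylor z (S n) k - w * chebT_taylor z n k)) in *.
  assert (hE : 0 <= E) by apply Cmod_ge_0.
  assert (E * / Cmod w * d ^ k <= (rho + d) * rho ^ n).
  { apply Rle_trans with (2 := h2); apply Rmult_le_compat_r; [lra|]; nra. }
  (* The choice of [d] and [B] makes the shifted term contribute exactly
     [(rho + d) (rho - 1) rho^n]; added to the inherited [(rho + d) rho^n], it closes the induction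
     with no loss. *)
  replace (2 * d * (B * rho ^ S n)) with (B * (2 * d * rho) * rho ^ n) in h4 by (simpl; ring).
  rewrite hd2 in h4.
  replace (B * ((rho - Cmod w) * (rho - 1)) * rho ^ n)
    with ((rho - Cmod w) * B * (rho - 1) * rho ^ n) in h4 by ring.
  rewrite hB in h4; rewrite <- (tech_pow_Rmult rho n); lra.
Qed.

Lemma C_filterlim_of_bound (u : nat -> C) (l : C) (c q : R) :
  0 <= q < 1 -> (forall n, Cmod (l - u n) <= c * q ^ n) ->
  filterlim u eventually (locally (l : C_NormedModule)).
Proof.
intros hq H.
apply (filterlim_locally_ball_norm (K := C_AbsRing) (U := C_NormedModule)); intros eps.
assert (hl : is_lim_seq (fun n => c * q ^ n) 0).
{ replace (Finite 0) with (Rbar_mult c 0) by (simpl; f_equal; ring).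
  apply is_lim_seq_scal_l, is_lim_seq_geom; rewrite Rabs_pos_eq; lra. }
generalize (proj1 (filterlim_locally _ _) hl eps); apply filter_imp; intros n hn.
change (Rabs (c * q ^ n - 0) < eps) in hn; rewrite Rminus_0_r in hn.
change (Cmod (u n - l) < eps).
replace (u n - l)%C with (- (l - u n))%C by ring; rewrite Cmod_opp.
eapply Rle_lt_trans; [apply H|]; eapply Rle_lt_trans; [apply Rle_abs | exact hn].
Qed.

(** An interchange of summations: the Taylor coefficients of the sum are the sums of the Taylor
    coefficients. The [N]-th Taylor polynomial is compared directly with the sum, and the tails are
    at most [K rho^(g n) 2^(-N)] for each [n], hence summable against [b]. *)
Lemma chebT_series_analytic (rho B q : R) (b : nat -> C) (g : nat -> nat) :
  1 < rho -> 0 <= B -> 0 <= q < 1 ->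
  (forall n, Cmod (b n) * rho ^ g n <= B * q ^ n) ->
  analytic_on (bernstein_ellipse rho) (fun zeta => CSeries (fun n => b n * chebT (g n) zeta)%C).
Proof.
intros hrho hB hq hb z hz.
destruct (joukowski_surj z) as (w & hw1 & hwz).
assert (hw : Cmod w < rho) by (apply bernstein_joukowski; [lra|lra|now rewrite hwz]).
set (d := (rho - Cmod w) * (rho - 1) / (2 * rho)).
assert (hd : 0 < d) by (unfold d; apply Rdiv_lt_0_compat; nra).
set (K := (rho + d) / (rho - Cmod w)).
assert (hK : 0 < K) by (unfold K; apply Rdiv_lt_0_compat; lra).
assert (ht : forall n k, Cmod (chebT_taylor z n k) * d ^ k <= K * rho ^ n).
{ intros n k; rewrite <- hwz; apply (chebT_taylor_bound rho w n k hrho); lra. }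
clearbody K d.
set (a := fun k => CSeries (fun n => b n * chebT_taylor z (g n) k)%C).
assert (ha : forall k, C_is_series (fun n => b n * chebT_taylor z (g n) k)%C (a k)).
{ intros k; apply CSeries_correct, (C_ex_series_geom _ (B * K * / d ^ k) q hq).
  intros n; rewrite Cmod_mult.
  assert (hdk : 0 < d ^ k) by now apply pow_lt.
  apply (Rmult_le_reg_r (d ^ k)); [exact hdk|].
  replace (B * K * / d ^ k * q ^ n * d ^ k) with (K * (B * q ^ n)) by (field; lra).
  apply Rle_trans with (K * (Cmod (b n) * rho ^ g n)).
  - generalize (ht (g n) k) (Cmod_ge_0 (b n)); intros; nra.
  - apply Rmult_le_compat_l; [lra | apply hb]. }
(* Half of the radius in [chebT_taylor_bound], so that the Taylor terms decay like [2^(-k)]. *)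
exists (d / 2), a; split; [lra|]; intros h hh.
assert (hterm : forall n k, Cmod (h ^ k * chebT_taylor z n k) <= K * rho ^ n * (/ 2) ^ k).
{ intros n k; rewrite Cmod_mult, Cmod_pow.
  apply Rle_trans with ((d * / 2) ^ k * Cmod (chebT_taylor z n k)).
  - apply Rmult_le_compat_r; [apply Cmod_ge_0|]; apply pow_incr; split; [apply Cmod_ge_0 | lra].
  - rewrite Rpow_mult_distr; generalize (ht n k).
    assert (0 < (/ 2) ^ k) by (apply pow_lt; lra); nra. }
assert (hser : forall n, C_is_series (fun k => h ^ k * chebT_taylor z n k)%C (chebT n (z + h)%C)).
{ intros n; generalize (chebT_taylor_correct z h n); apply is_series_ext.
  intros k; now rewrite pow_n_Cpow. }
assert (hrn : forall n, 0 < rho ^ n) by (intros; apply pow_lt; lra).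
assert (hbn : forall n X, 0 <= X -> Cmod (b n) * (rho ^ g n * X) <= B * q ^ n * X).
{ intros n X hX; rewrite <- Rmult_assoc; apply Rmult_le_compat_r; [exact hX | apply hb]. }
assert (hS : C_is_series (fun n => b n * chebT (g n) (z + h)%C)%C
               (CSeries (fun n => b n * chebT (g n) (z + h)%C)%C)).
{ apply CSeries_correct, (C_ex_series_geom _ (2 * K * B) q hq).
  intros n; rewrite Cmod_mult.
  assert (hT : Cmod (chebT (g n) (z + h)%C) <= rho ^ g n * (2 * K)).
  { apply (C_is_series_bound _ _ _ (hser (g n))); intros m.
    replace (rho ^ g n * (2 * K)) with (K * rho ^ g n / (1 - / 2)) by field.
    apply sum_geom_bound; [|lra|apply hterm].
    apply Rmult_le_pos; [lra | left; apply hrn]. }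
  eapply Rle_trans; [apply Rmult_le_compat_l; [apply Cmod_ge_0 | exact hT]|].
  generalize (hbn n (2 * K)); lra. }
apply (C_filterlim_of_bound _ _ (B * K / (1 - q)) (/ 2)); [lra|]; intros N.
set (p := fun n => sum_n (G := C_AbelianMonoid) (fun k => h ^ k * chebT_taylor z n k)%C N).
assert (hp : C_is_series (fun n => b n * p (g n))%C
   (sum_n (G := C_AbelianMonoid) (fun k => scal (pow_n (K := C_AbsRing) h k) (a k : C_NormedModule)) N)).
{ unfold p; clear p; induction N as [|N IH].
  - rewrite sum_O, pow_n_Cpow.
    generalize (C_is_series_scal (h ^ 0) _ _ (ha 0%nat)); apply is_series_ext; intros n.
    rewrite sum_O; simpl; ring.
  - rewrite sum_Sn, pow_n_Cpow.
    generalize (is_series_plus _ _ _ _ IH (C_is_series_scal (h ^ S N) _ _ (ha (S N)))).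
    apply is_series_ext; intros n; rewrite sum_Sn; unfold plus; simpl; ring. }
apply (C_is_series_bound _ _ _ (C_is_series_minus _ _ _ _ hS hp)); intros m.
replace (B * K / (1 - q) * (/ 2) ^ N) with (B * K * (/ 2) ^ N / (1 - q)) by (field; lra).
assert (hhalf : 0 < (/ 2) ^ N) by (apply pow_lt; lra).
assert (hKN : 0 <= K * (/ 2) ^ N) by nra.
apply sum_geom_bound; [|exact hq|].
- repeat apply Rmult_le_pos; lra.
- intros n.
  replace (b n * chebT (g n) (z + h)%C - b n * p (g n))%C
    with (b n * (chebT (g n) (z + h)%C - p (g n)))%C by ring.
  rewrite Cmod_mult.
  assert (hT : Cmod (chebT (g n) (z + h)%C - p (g n)) <= rho ^ g n * (K * (/ 2) ^ N)).
  { eapply Rle_trans; [apply (C_is_series_tail _ _ (K * rho ^ g n) (/ 2) N)|].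
    - apply Rmult_le_pos; [lra | left; apply hrn].
    - lra.
    - apply hser.
    - apply hterm.
    - right; simpl; field. }
  eapply Rle_trans; [apply Rmult_le_compat_l; [apply Cmod_ge_0 | exact hT]|].
  generalize (hbn n (K * (/ 2) ^ N)); lra.
Qed.

(** * The function [M]: convergence, analyticity and size *)

Lemma analytic_on_scal (D : C -> Prop) (c : C) (f g : C -> C) :
  (forall z, g z = c * f z)%C -> analytic_on D f -> analytic_on D g.
Proof.
intros hg Hf z hz; destruct (Hf z hz) as (r & a & hr & H).
exists r, (fun k => c * a k)%C; split; [exact hr|]; intros h hh; rewrite hg.
generalize (is_pseries_scal c _ h _ (Cmult_comm _ _) (H h hh)); now apply C_is_pseries_ext.
Qed.

Lemma CSeries_ext (a b : nat -> C) : (forall n, a n = b n) -> CSeries a = CSeries b.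
Proof.
intros H; unfold CSeries; f_equal; apply Series_ext; intros n; now rewrite H.
Qed.

(** Below the threshold the damping is ignored and the terms grow with ratio [x > 1]; beyond it they
    are dominated by a geometric sequence of ratio [x / rho^2 < 1]. The two summands of the constant
    are the two geometric sums. *)
Lemma damped_geom_sum_bound (rho eps x : R) (N m : nat) :
  1 < rho -> 0 < eps -> 1 < x < rho ^ 2 -> eps * rho ^ N <= 1 < eps * rho ^ S N ->
  sum_f_R0 (fun n => x ^ S n / (1 + eps ^ 2 * rho ^ (2 * S n))) m
    <= (x / (x - 1) + x / (1 - x / rho ^ 2)) * x ^ N.
Proof.
intros hrho heps hx hN.
set (term := fun n => x ^ S n / (1 + eps ^ 2 * rho ^ (2 * S n))).
set (y := x / rho ^ 2).
assert (hr2 : 0 < rho ^ 2) by (apply pow_lt; lra).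
assert (hy : 0 < y < 1).
{ unfold y; split; [apply Rdiv_lt_0_compat; lra|].
  apply (Rmult_lt_reg_r (rho ^ 2)); [exact hr2|]; unfold Rdiv.
  rewrite Rmult_assoc, Rinv_l; lra. }
assert (hxp : forall n, 0 < x ^ n) by (intros; apply pow_lt; lra).
assert (hrp : forall n, 0 < rho ^ n) by (intros; apply pow_lt; lra).
assert (he2 : 0 < eps ^ 2) by now apply pow_lt.
assert (hden : forall n, 0 < eps ^ 2 * rho ^ (2 * S n)).
{ intros; now apply Rmult_lt_0_compat. }
assert (t1 : forall n, term n <= x ^ S n).
{ intros n; unfold term; specialize (hden n); specialize (hxp (S n)).
  apply (Rmult_le_reg_r (1 + eps ^ 2 * rho ^ (2 * S n))); [lra|].
  unfold Rdiv; rewrite Rmult_assoc, Rinv_l, Rmult_1_r by lra; nra. }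
assert (t2 : forall i, term (N + i)%nat <= x ^ S N * y ^ i).
{ intros i; unfold term.
  assert (h0 : y ^ i = x ^ i * / (rho ^ 2) ^ i)
    by (unfold y, Rdiv; now rewrite Rpow_mult_distr, pow_inv).
  assert (h1 : x ^ S (N + i) = x ^ S N * x ^ i) by (rewrite <- pow_add; f_equal).
  assert (h2 : eps ^ 2 * rho ^ (2 * S (N + i)) = (eps * rho ^ S N) ^ 2 * (rho ^ 2) ^ i).
  { rewrite Rpow_mult_distr, <- !pow_mult, Rmult_assoc, <- pow_add; do 2 f_equal; lia. }
  assert (h3 : 1 < (eps * rho ^ S N) ^ 2) by nra.
  assert (h4 : 0 < (rho ^ 2) ^ i) by now apply pow_lt.
  rewrite h0, h1, h2; unfold Rdiv; rewrite Rmult_assoc.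
  apply Rmult_le_compat_l; [left; apply hxp|].
  apply Rmult_le_compat_l; [left; apply hxp|].
  apply Rinv_le_contravar; nra. }
(* The index [k] carries the exponent [k + 1], so the growing part up to [N - 1] is at most
   [x^(N + 1) / (x - 1)]. *)
assert (s1 : forall k, sum_f_R0 term k <= x ^ S (S k) / (x - 1)).
{ induction k as [|k IH].
  - simpl sum_f_R0; apply (Rle_trans _ _ _ (t1 0%nat)).
    apply (Rmult_le_reg_r (x - 1)); [lra|]; simpl; field_simplify; nra.
  - simpl sum_f_R0; apply Rle_trans with (1 := Rplus_le_compat _ _ _ _ IH (t1 (S k))).
    right; simpl; field; lra. }
assert (s2 : forall i, sum_f_R0 term (N + i) <=
   x ^ S N / (x - 1) + x ^ S N * (1 - y ^ S i) / (1 - y)).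
{ induction i as [|i IH].
  - replace (x ^ S N * (1 - y ^ 1) / (1 - y)) with (x ^ S N) by (field; lra).
    generalize (t2 0%nat); rewrite Nat.add_0_r, pow_O, Rmult_1_r; intros h.
    destruct N as [|k].
    + simpl sum_f_R0; assert (0 < x ^ 1 / (x - 1)); [|lra].
      apply Rdiv_lt_0_compat; [apply hxp | lra].
    + simpl sum_f_R0; exact (Rplus_le_compat _ _ _ _ (s1 k) h).
  - rewrite Nat.add_succ_r; simpl sum_f_R0.
    generalize (t2 (S i)); rewrite Nat.add_succ_r; intros h.
    apply Rle_trans with (1 := Rplus_le_compat _ _ _ _ IH h).
    right; simpl; field; lra. }
assert (hfin : (x / (x - 1) + x / (1 - y)) * x ^ N = x ^ S N / (x - 1) + x ^ S N / (1 - y)).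
{ simpl; field; lra. }
rewrite hfin.
assert (hpos : 0 < x ^ S N / (1 - y)) by (apply Rdiv_lt_0_compat; [apply hxp | lra]).
destruct (Nat.le_gt_cases N m) as [h|h].
- replace m with (N + (m - N))%nat by lia; apply Rle_trans with (1 := s2 _).
  apply Rplus_le_compat_l; unfold Rdiv; apply Rmult_le_compat_r.
  + left; apply Rinv_0_lt_compat; lra.
  + assert (0 < y ^ S (m - N)) by (apply pow_lt; lra); generalize (hxp (S N)); nra.
- apply Rle_trans with (1 := s1 m).
  assert (x ^ S (S m) / (x - 1) <= x ^ S N / (x - 1)); [|lra].
  unfold Rdiv; apply Rmult_le_compat_r; [left; apply Rinv_0_lt_compat; lra|].
  apply Rle_pow; [lra | lia].
Qed.

(** The parameter [s] is the growth rate of the Chebyshev polynomials at [zeta]; it will be [rho] on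
    the ellipse, 1 on the segment and [|Jinv z|] at [z]. *)
Lemma M_term_bound (rho eps s : R) (z zeta : C) (n : nat) :
  1 < rho -> 0 < eps -> (forall n, Cmod (chebT n zeta) <= s ^ n) ->
  Cmod (M_term rho z eps zeta n)
    <= (Cmod (Jinv z) * s) ^ S n / (1 + eps ^ 2 * rho ^ (2 * S n)).
Proof.
intros hrho heps hs; unfold M_term.
assert (hden : 0 < 1 + eps ^ 2 * rho ^ (2 * S n)).
{ assert (0 < eps ^ 2) by now apply pow_lt.
  assert (0 < rho ^ (2 * S n)) by (apply pow_lt; lra); nra. }
rewrite Cmod_div.
- rewrite Cmod_R, (Rabs_pos_eq (1 + _)) by lra.
  unfold Rdiv; apply Rmult_le_compat_r; [left; now apply Rinv_0_lt_compat|].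
  rewrite Cmod_mult, Cmod_pow, Cmod_conj, Rpow_mult_distr.
  apply Rmult_le_compat_l; [apply pow_le, Cmod_ge_0 | apply hs].
- intros h; apply RtoC_inj in h; lra.
Qed.

Lemma Cmod_chebT_ellipse (rho : R) (zeta : C) (n : nat) :
  1 < rho -> bernstein_ellipse rho zeta -> Cmod (chebT n zeta) <= rho ^ n.
Proof.
intros hrho hzeta; destruct (joukowski_surj zeta) as (w & hw & <-).
apply bernstein_joukowski in hzeta; [|lra|lra].
apply Rle_trans with (1 := Cmod_chebT_joukowski n w hw); apply pow_incr; lra.
Qed.

Lemma Cmod_chebT_segment (x : R) (n : nat) :
  -1 <= x <= 1 -> Cmod (chebT n (RtoC x)) <= 1.
Proof.
intros hx; rewrite chebT_cos, Cmod_R by exact hx.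
apply Rabs_le_between; generalize (COS_bound (INR n * acos x)); lra.
Qed.

(** Drops the 1 in the denominator. The factor [/ eps ^ 2] is not uniform in [eps], so this serves
    convergence and analyticity and not the sizes. *)
Lemma damped_pow_geom (rho eps r : R) (n : nat) : 1 < rho -> 0 < eps -> 0 <= r ->
  (r * rho) ^ n / (1 + eps ^ 2 * rho ^ (2 * n)) <= / eps ^ 2 * (r / rho) ^ n.
Proof.
intros hrho heps hr.
assert (h1 : 0 < rho ^ n) by (apply pow_lt; lra).
assert (h2 : 0 < eps ^ 2) by now apply pow_lt.
assert (h3 : 0 <= r ^ n) by now apply pow_le.
replace (2 * n)%nat with (n + n)%nat by lia.
rewrite pow_add; unfold Rdiv; rewrite !Rpow_mult_distr, pow_inv.
apply (Rmult_le_reg_r (1 + eps ^ 2 * (rho ^ n * rho ^ n))); [nra|].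
rewrite (Rmult_assoc _ (/ (1 + _))), Rinv_l by nra.
replace (/ eps ^ 2 * (r ^ n * / rho ^ n) * (1 + eps ^ 2 * (rho ^ n * rho ^ n)))
  with (r ^ n * / rho ^ n * / eps ^ 2 + r ^ n * rho ^ n) by (field; split; lra).
assert (0 <= r ^ n * / rho ^ n * / eps ^ 2).
{ repeat apply Rmult_le_pos; try lra; left; now apply Rinv_0_lt_compat. }
lra.
Qed.

Lemma M_term_geom (rho eps : R) (z zeta : C) (n : nat) :
  1 < rho -> 0 < eps -> bernstein_ellipse rho zeta ->
  Cmod (M_term rho z eps zeta n)
    <= / eps ^ 2 * (Cmod (Jinv z) / rho) * (Cmod (Jinv z) / rho) ^ n.
Proof.
intros hrho heps hzeta.
eapply Rle_trans; [apply (M_term_bound rho eps rho); auto|].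
- intros k; now apply Cmod_chebT_ellipse.
- rewrite Rmult_assoc; apply damped_pow_geom; auto using Cmod_ge_0.
Qed.

Lemma M_term_ex_series (rho eps : R) (z zeta : C) :
  1 < rho -> Cmod (Jinv z) < rho -> 0 < eps -> bernstein_ellipse rho zeta ->
  C_ex_series (M_term rho z eps zeta).
Proof.
intros hrho hw heps hzeta.
apply (C_ex_series_geom _ (/ eps ^ 2 * (Cmod (Jinv z) / rho)) (Cmod (Jinv z) / rho)).
- generalize (Cmod_ge_0 (Jinv z)); intros; split.
  + unfold Rdiv; apply Rmult_le_pos; [lra | left; apply Rinv_0_lt_compat; lra].
  + apply (Rmult_lt_reg_r rho); [lra|]; field_simplify; lra.
- intros k; now apply M_term_geom.
Qed.

Lemma M_bound (rho eps s : R) (z zeta : C) (N : nat) :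
  1 < rho -> Cmod (Jinv z) < rho -> 0 < eps -> bernstein_ellipse rho zeta ->
  (forall n, Cmod (chebT n zeta) <= s ^ n) ->
  let x := Cmod (Jinv z) * s in
  1 < x < rho ^ 2 -> eps * rho ^ N <= 1 < eps * rho ^ S N ->
  Cmod (M rho z eps zeta)
    <= Rpower eps (2 - alpha rho z) * ((x / (x - 1) + x / (1 - x / rho ^ 2)) * x ^ N).
Proof.
intros hrho hw heps hzeta hs x hx hN; unfold M.
rewrite Cmod_mult, Cmod_R, Rabs_pos_eq by (left; apply exp_pos).
apply Rmult_le_compat_l; [left; apply exp_pos|].
apply (C_is_series_bound _ _ _ (CSeries_correct _ (M_term_ex_series _ _ _ _ hrho hw heps hzeta))).
intros m; eapply Rle_trans; [|apply (damped_geom_sum_bound rho eps x N m); auto].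
apply sum_Rle; intros k _; now apply M_term_bound.
Qed.

Lemma M_analytic (rho eps : R) (z : C) : 1 < rho -> Cmod (Jinv z) < rho -> 0 < eps ->
  analytic_on (bernstein_ellipse rho) (M rho z eps).
Proof.
intros hrho hw heps.
set (q := Cmod (Jinv z) / rho).
assert (hw0 := Cmod_ge_0 (Jinv z)).
assert (hq : 0 <= q < 1).
{ unfold q; split.
  + unfold Rdiv; apply Rmult_le_pos; [lra | left; apply Rinv_0_lt_compat; lra].
  + apply (Rmult_lt_reg_r rho); [lra|]; field_simplify; lra. }
set (b := fun n => (Cconj (Jinv z) ^ S n / RtoC (1 + eps ^ 2 * rho ^ (2 * S n)))%C).
assert (hden : forall n, 0 < 1 + eps ^ 2 * rho ^ (2 * n)).
{ intros n; assert (0 < eps ^ 2) by now apply pow_lt.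
  assert (0 < rho ^ (2 * n)) by (apply pow_lt; lra); nra. }
assert (hden' : forall n, RtoC (1 + eps ^ 2 * rho ^ (2 * n)) <> 0).
{ intros n h; apply RtoC_inj in h; generalize (hden n); lra. }
apply (analytic_on_scal _ (RtoC (Rpower eps (2 - alpha rho z)))
   (fun zeta => CSeries (fun n => b n * chebT (S n) zeta)%C)).
- intros zeta; unfold M; f_equal; apply CSeries_ext; intros n; unfold M_term, b.
  unfold Cdiv; ring.
- apply (chebT_series_analytic rho (/ eps ^ 2 * q) q); auto.
  + apply Rmult_le_pos; [left; apply Rinv_0_lt_compat; now apply pow_lt | lra].
  + intros n; unfold b; rewrite Cmod_div by apply hden'.
    rewrite Cmod_R, (Rabs_pos_eq (1 + _)), Cmod_pow, Cmod_conj by (left; apply hden).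
    replace (Cmod (Jinv z) ^ S n / (1 + eps ^ 2 * rho ^ (2 * S n)) * rho ^ S n)
      with ((Cmod (Jinv z) * rho) ^ S n / (1 + eps ^ 2 * rho ^ (2 * S n)))
      by (rewrite Rpow_mult_distr; field; generalize (hden (S n)); lra).
    rewrite Rmult_assoc; now apply damped_pow_geom.
Qed.

Lemma Series_ge_term (a : nat -> R) (k : nat) :
  ex_series a -> (forall n, 0 <= a n) -> a k <= Series a.
Proof.
intros hex h0.
apply Rle_trans with (sum_n a k).
- destruct k as [|k]; [rewrite sum_O; lra|].
  rewrite sum_Sn, sum_n_Reals; unfold plus; simpl.
  generalize (cond_pos_sum a k h0); lra.
- apply (is_lim_seq_incr_compare (sum_n a) (Series a)); [now apply Series_correct|].
  intros n; rewrite sum_Sn; unfold plus; simpl; generalize (h0 (S n)); lra.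
Qed.

(** The conjugate in [M] aligns the phases: with [m = S n], [conj(w)^m T_m (J w)] is half of
    [|w|^(2m) + (conj(w) / w)^m], and the last power is unimodular, with real part at least -1. *)
Lemma M_term_diag_Re (rho eps : R) (z : C) (n : nat) :
  1 < rho -> 0 < eps -> 1 < Cmod (Jinv z) -> joukowski (Jinv z) = z ->
  (Cmod (Jinv z) ^ (2 * S n) - 1) / (2 * (1 + eps ^ 2 * rho ^ (2 * S n)))
    <= Re (M_term rho z eps z n).
Proof.
intros hrho heps hw hz.
set (w := Jinv z) in *.
assert (hw0 : w <> 0) by (apply Cneq_0_of_Cmod; lra).
assert (hwn : (w ^ S n)%C <> 0) by now apply Cpow_nz.
assert (hden : 0 < 1 + eps ^ 2 * rho ^ (2 * S n)).
{ assert (0 < eps ^ 2) by now apply pow_lt.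
  assert (0 < rho ^ (2 * S n)) by (apply pow_lt; lra); nra. }
set (D := 1 + eps ^ 2 * rho ^ (2 * S n)) in *.
assert (hD : RtoC D <> 0) by (intros h; apply RtoC_inj in h; lra).
set (c := (Cconj w ^ S n / w ^ S n)%C).
assert (hc : Cmod c = 1).
{ unfold c; rewrite Cmod_div, !Cmod_pow, Cmod_conj by exact hwn.
  apply Rinv_r, pow_nonzero; lra. }
assert (hcw : (Cconj w ^ S n * w ^ S n)%C = RtoC (Cmod w ^ (2 * S n))).
{ rewrite <- Cpow_mult_l, Cmult_comm, <- Cmod2_conj, RtoC_pow, <- Cpow_mult_r.
  now rewrite <- !RtoC_pow. }
assert (e : M_term rho z eps z n = (RtoC (/ (2 * D)) * (RtoC (Cmod w ^ (2 * S n)) + c))%C).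
{ unfold M_term; fold w D; rewrite <- hz at 1; rewrite chebT_joukowski by exact hw0.
  rewrite <- hcw, RtoC_inv, RtoC_mult by lra; unfold c; field.
  repeat split; auto; apply Ctwo_neq_0. }
rewrite e.
replace (Re (RtoC (/ (2 * D)) * (RtoC (Cmod w ^ (2 * S n)) + c)))
  with (/ (2 * D) * (Cmod w ^ (2 * S n) + Re c)) by (destruct c; simpl; ring).
unfold Rdiv; rewrite Rmult_comm; apply Rmult_le_compat_l.
- left; apply Rinv_0_lt_compat; lra.
- generalize (re_le_Cmod c); rewrite hc; intros h; apply Rabs_le_between in h; lra.
Qed.

Lemma M_lower_bound (rho eps : R) (z : C) (N : nat) :
  1 < rho -> bernstein_ellipse rho z -> 0 < eps -> 1 < Cmod (Jinv z) < rho ->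
  joukowski (Jinv z) = z -> eps * rho ^ S N <= 1 ->
  Rpower eps (2 - alpha rho z) * ((Cmod (Jinv z) ^ (2 * S N) - 1) / 4) <= Cmod (M rho z eps z).
Proof.
intros hrho hz heps hw hJ hN; unfold M.
rewrite Cmod_mult, Cmod_R, Rabs_pos_eq by (left; apply exp_pos).
apply Rmult_le_compat_l; [left; apply exp_pos|].
apply Rle_trans with (Re (CSeries (M_term rho z eps z)));
  [|generalize (re_le_Cmod (CSeries (M_term rho z eps z))); generalize (Rle_abs (Re (CSeries (M_term rho z eps z)))); lra].
assert (hpos : forall n, 0 < Cmod (Jinv z) ^ (2 * S n) - 1).
{ intros n; assert (1 < Cmod (Jinv z) ^ (2 * S n)) by (apply Rlt_pow_R1; [lra|lia]); lra. }
assert (hden : forall n, 0 < 1 + eps ^ 2 * rho ^ (2 * n)).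
{ intros n; assert (0 < eps ^ 2) by now apply pow_lt.
  assert (0 < rho ^ (2 * n)) by (apply pow_lt; lra); nra. }
simpl Re.
(* The term of index [N] has exponent [N + 1], where [eps rho^(N + 1) <= 1] bounds its denominator
   by 4. *)
apply Rle_trans with (Re (M_term rho z eps z N)).
- eapply Rle_trans; [|apply M_term_diag_Re; tauto].
  unfold Rdiv; apply Rmult_le_compat_l; [left; apply hpos|].
  apply Rinv_le_contravar; [generalize (hden (S N)); lra|].
  assert (0 < eps * rho ^ S N) by (apply Rmult_lt_0_compat; [lra | apply pow_lt; lra]).
  replace (eps ^ 2 * rho ^ (2 * S N)) with ((eps * rho ^ S N) ^ 2); [nra|].
  rewrite Rpow_mult_distr, <- pow_mult; f_equal; f_equal; lia.
- apply (Series_ge_term (fun n => Re (M_term rho z eps z n))).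
  + apply (ex_series_le (K := R_AbsRing) (V := R_CompleteNormedModule) _
      (fun n => / eps ^ 2 * (Cmod (Jinv z) / rho) * (Cmod (Jinv z) / rho) ^ n)).
    * intros n; eapply Rle_trans; [apply re_le_Cmod | now apply M_term_geom].
    * apply (ex_series_scal (K := R_AbsRing) (V := R_NormedModule)), ex_series_geom.
      assert (0 < / rho) by (apply Rinv_0_lt_compat; lra).
      rewrite Rabs_pos_eq by (unfold Rdiv; nra).
      apply (Rmult_lt_reg_r rho); [lra|]; field_simplify; lra.
  + intros n; eapply Rle_trans; [|apply M_term_diag_Re; tauto].
    left; apply Rdiv_lt_0_compat; [apply hpos | generalize (hden (S n)); lra].
Qed.

(** * From integer to real exponents, and the theorem *)

Lemma pow_le_Rpower (x lam : R) (n : nat) : 1 < x -> INR n <= lam -> x ^ n <= Rpower x lam.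
Proof.
intros hx hn; rewrite <- Rpower_pow by lra; apply Rle_Rpower; lra.
Qed.

Lemma exp_le_compat (x y : R) : x <= y -> exp x <= exp y.
Proof.
intros [h | ->]; [left; now apply exp_increasing | apply Rle_refl].
Qed.

Lemma exponent_floor (rho eps : R) : 1 < rho -> 0 < eps < 1 ->
  exists n : nat, INR n <= - ln eps / ln rho < INR n + 1 /\
    eps * rho ^ n <= 1 < eps * rho ^ S n.
Proof.
intros hrho heps.
assert (hL : 0 < ln rho) by (rewrite <- ln_1; apply ln_increasing; lra).
assert (hl : ln eps < 0) by (rewrite <- ln_1; apply ln_increasing; lra).
set (lam := - ln eps / ln rho).
assert (hlam : ln eps = - lam * ln rho) by (unfold lam; field; lra).
assert (h0 : 0 <= lam) by (unfold lam; apply Rdiv_le_0_compat; lra).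
destruct (nfloor_ex lam h0) as [n hn]; exists n; split; [exact hn|].
assert (e : forall k, eps * rho ^ k = exp ((INR k - lam) * ln rho)).
{ intros k; rewrite <- (exp_ln eps) at 1 by lra.
  rewrite <- Rpower_pow by lra; unfold Rpower; rewrite <- exp_plus, hlam; f_equal; ring. }
rewrite !e, S_INR; split.
- apply Rle_trans with (exp 0); [apply exp_le_compat; nra | rewrite exp_0; lra].
- apply Rle_lt_trans with (exp 0); [rewrite exp_0; lra | apply exp_increasing; nra].
Qed.

Theorem theorem2p6 (rho : R) (hrho : 1 < rho) (z : C)
    (hz : bernstein_ellipse rho z) (hz' : ~ segment z) :
  0 < alpha rho z < 1 /\
  (exists K : R, 0 < K /\
     forall (eps : R) (F : C -> C), 0 < eps ->
       Hinf (bernstein_ellipse rho) F ->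
       Rbar_le (Hinf_norm (bernstein_ellipse rho) F) 1 ->
       Rbar_le (Linf_norm (-1) 1 (fun x => F (RtoC x))) eps ->
       Cmod (F z) <= K * Rpower eps (alpha rho z)) /\
  (forall (eps : R) (zeta : C), 0 < eps -> bernstein_ellipse rho zeta ->
     ex_series (K := C_AbsRing) (V := C_NormedModule) (M_term rho z eps zeta)) /\
  (exists c1 c2 c3 c4 eps0 : R,
     0 < c1 /\ 0 < c2 /\ 0 < c3 /\ 0 < c4 /\ 0 < eps0 /\
     forall eps : R, 0 < eps < eps0 ->
       Hinf (bernstein_ellipse rho) (M rho z eps) /\
       Rbar_le (Hinf_norm (bernstein_ellipse rho) (M rho z eps)) c1 /\
       Rbar_le (Linf_norm (-1) 1 (fun x => M rho z eps (RtoC x))) (c2 * eps) /\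
       c3 * Rpower eps (alpha rho z) <= Cmod (M rho z eps z)
         <= c4 * Rpower eps (alpha rho z)).
Proof.
destruct (Jinv_spec rho z hrho hz hz') as [hw hJ].
set (r := Cmod (Jinv z)) in *.
assert (hL : 0 < ln rho) by (rewrite <- ln_1; apply ln_increasing; lra).
assert (hl : 0 < ln r) by (rewrite <- ln_1; apply ln_increasing; lra).
assert (hlL : ln r < ln rho) by (apply ln_increasing; lra).
set (beta := ln r / ln rho).
assert (hbeta : 0 < beta < 1).
{ unfold beta; split; [now apply Rdiv_lt_0_compat|].
  apply (Rmult_lt_reg_r (ln rho)); [exact hL|]; field_simplify; lra. }
assert (hlr : ln r = beta * ln rho) by (unfold beta; field; lra).
assert (halpha : alpha rho z = 1 - beta) by reflexivity.
assert (segE : forall x, -1 <= x <= 1 -> bernstein_ellipse rho (RtoC x)).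
{ intros x hx; unfold bernstein_ellipse; rewrite <- RtoC_minus, <- RtoC_plus, !Cmod_R.
  rewrite Rabs_left1, Rabs_pos_eq by lra.
  generalize (inv_sum_lt 1 rho hrho); rewrite Rinv_1; intros h.
  generalize (proj2 (h ltac:(lra)) hrho); lra. }
split; [lra|split; [|split]].
(* The factor 2 comes from [three_circles], and [rho / r] pays for passing from the exponent [n] to
   [n + 1]. *)
- exists (2 * (rho / r)); split; [apply Rmult_lt_0_compat; [lra | apply Rdiv_lt_0_compat; lra]|].
  intros eps F heps [hFan _] hF1 hFe.
  assert (h1 := Hinf_norm_pointwise _ _ _ hF1).
  assert (hK : 1 <= rho / r).
  { apply (Rmult_le_reg_r r); [lra|]; field_simplify; lra. }
  (* For [eps >= 1] the norm bound [|F z| <= 1] is already enough; [exponent_floor] handles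
     [eps < 1]. *)
  destruct (Rle_or_lt 1 eps) as [hge|hlt].
  { apply Rle_trans with (1 := h1 z hz).
    assert (1 <= Rpower eps (alpha rho z)); [|nra].
    rewrite <- (Rpower_O eps heps) at 1; apply Rle_Rpower; lra. }
  assert (hseg : forall x, -1 <= x <= 1 -> Cmod (F (RtoC x)) <= eps).
  { apply (Linf_norm_pointwise (-1) 1 eps (fun x => F (RtoC x))); [lra| |exact hFe].
    intros x eta hx heta.
    destruct (bigO_nonneg _ _ (second_order_bounded _ _
      (analytic_second_order _ _ _ hFan (segE x hx)))) as (L & d & hLp & hd & HL).
    exists (Rmin d (eta / (L + 1))); split.
    - apply Rmin_glb_lt; [lra | apply Rdiv_lt_0_compat; lra].
    - intros y hy.
      assert (y1 : Rabs (y - x) < d) by (eapply Rlt_le_trans; [exact hy | apply Rmin_l]).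
      assert (y2 : Rabs (y - x) < eta / (L + 1)) by (eapply Rlt_le_trans; [exact hy | apply Rmin_r]).
      apply (Rmult_lt_compat_r (L + 1)) in y2; [|lra].
      replace (eta / (L + 1) * (L + 1)) with eta in y2 by (field; lra).
      rewrite <- Cmod_R in y1, y2.
      specialize (HL _ y1); simpl in HL; rewrite Rmult_1_r in HL.
      replace (RtoC x + RtoC (y - x))%C with (RtoC y) in HL by (rewrite RtoC_minus; ring).
      generalize (Cmod_triangle_minus (F (RtoC y)) (F (RtoC y) - F (RtoC x))).
      replace (F (RtoC y) - (F (RtoC y) - F (RtoC x)))%C with (F (RtoC x)) by ring.
      generalize (Cmod_ge_0 (RtoC (y - x))); lra. }
  destruct (exponent_floor rho eps hrho ltac:(lra)) as (n & hn & hpn).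
  set (lam := - ln eps / ln rho) in *.
  assert (hT := three_circles rho eps F n (Jinv z) hrho hFan h1 hseg ltac:(lra) hw).
  rewrite hJ in hT; fold r in hT.
  apply Rle_trans with (1 := hT); rewrite Rmult_assoc; apply Rmult_le_compat_l; [lra|].
  assert (hq : 0 < r / rho) by (apply Rdiv_lt_0_compat; lra).
  assert (hlnq : ln (r / rho) = ln r - ln rho) by (apply ln_div; lra).
  (* Since [r / rho < 1], only an exponent above [lam] gives a bound by [(r / rho)^lam = eps^alpha];
     the floor [n] lies below it, [n + 1] above. *)
  replace ((r / rho) ^ n) with (rho / r * (r / rho) ^ S n) by (simpl; field; lra).
  apply Rmult_le_compat_l; [lra|].
  rewrite <- Rpower_pow by exact hq; unfold Rpower.
  rewrite hlnq, S_INR, halpha.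
  apply exp_le_compat.
  replace (ln eps) with (- lam * ln rho) by (unfold lam; field; lra).
  rewrite hlr; replace ((1 - beta) * (- lam * ln rho)) with (lam * (beta * ln rho - ln rho)) by ring.
  assert (beta * ln rho - ln rho < 0) by lra. nra.
- intros eps zeta heps hzeta; apply M_term_ex_series; auto; apply hw.
- set (con := fun x => x / (x - 1) + x / (1 - x / rho ^ 2)).
  assert (hr2 : 0 < rho ^ 2) by (apply pow_lt; lra).
  assert (hcon : forall x, 1 < x < rho ^ 2 -> 0 < con x).
  { intros x hx; unfold con.
    assert (x / rho ^ 2 < 1) by (apply (Rmult_lt_reg_r (rho ^ 2)); [lra|]; field_simplify; lra).
    apply Rplus_lt_0_compat; apply Rdiv_lt_0_compat; lra. }
  assert (x1 : 1 < r * rho < rho ^ 2) by nra.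
  assert (x2 : 1 < r * 1 < rho ^ 2) by nra.
  assert (x3 : 1 < r * r < rho ^ 2) by nra.
  assert (hr22 : / r ^ 2 < 1).
  { rewrite <- Rinv_1; apply Rinv_lt_contravar; nra. }
  assert (hr20 : 0 < / r ^ 2) by (apply Rinv_0_lt_compat, pow_lt; lra).
  (* The upper constants are [con (r s)] for the three growth rates [s]. For the third constant,
     [n = N + 1] and [lam < N + 2] give [(r r)^lam <= (r r)^(N + 2)]; the constant times this power
     is [((r r)^(N + 1) - (r r)^N) / 4], at most the [((r r)^(N + 1) - 1) / 4] of
     [M_lower_bound]. *)
  exists (con (r * rho)), (con (r * 1)), ((1 - / r ^ 2) * / r ^ 2 / 4), (con (r * r)), (/ rho).
  split; [auto|split; [auto|split; [|split; [auto|split]]]].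
  { unfold Rdiv; repeat apply Rmult_lt_0_compat; lra. }
  { apply Rinv_0_lt_compat; lra. }
  intros eps heps.
  assert (hrhoi : / rho < 1) by (rewrite <- Rinv_1; apply Rinv_lt_contravar; lra).
  destruct (exponent_floor rho eps hrho ltac:(lra)) as (n & hn & hpn).
  set (lam := - ln eps / ln rho) in *.
  assert (hleps : ln eps = - lam * ln rho) by (unfold lam; field; lra).
  (* For [eps < 1 / rho] one has [lam > 1]. The series starts at exponent 1, so a term of exponent
     [n] exists only when [n >= 1]. *)
  assert (hn1 : (1 <= n)%nat).
  { destruct n as [|n]; [|lia]; simpl in hn; exfalso.
    assert (ln eps < ln (/ rho)) by (apply ln_increasing; lra).
    rewrite ln_Rinv in H by lra; nra. }
  assert (hE : forall x, 0 < x -> Rpower eps (2 - alpha rho z) * Rpower x lam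
     = exp (- (1 + beta) * lam * ln rho + lam * ln x)).
  { intros x hx; unfold Rpower; rewrite <- exp_plus, halpha, hleps; f_equal; ring. }
  (* As [rho^lam = 1 / eps] and [r^lam = eps^(-beta)], the prefactor [eps^(1 + beta)] turns the
     three largest terms into [1], [eps] and [eps^(1 - beta)]. *)
  assert (g1 : Rpower eps (2 - alpha rho z) * Rpower (r * rho) lam = 1).
  { rewrite hE, ln_mult, hlr by lra.
    transitivity (exp 0); [f_equal; ring | apply exp_0]. }
  assert (g2 : Rpower eps (2 - alpha rho z) * Rpower (r * 1) lam = eps).
  { rewrite hE, Rmult_1_r, hlr by lra.
    transitivity (exp (ln eps)); [rewrite hleps; f_equal; ring | apply exp_ln; lra]. }
  assert (g3 : Rpower eps (2 - alpha rho z) * Rpower (r * r) lam = Rpower eps (alpha rho z)).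
  { rewrite hE, ln_mult, hlr by lra; unfold Rpower; rewrite halpha, hleps; f_equal; ring. }
  assert (hE0 : 0 < Rpower eps (2 - alpha rho z)) by apply exp_pos.
  assert (hMb : forall s zeta, bernstein_ellipse rho zeta ->
     (forall n, Cmod (chebT n zeta) <= s ^ n) -> 1 < r * s < rho ^ 2 ->
     Cmod (M rho z eps zeta)
       <= con (r * s) * (Rpower eps (2 - alpha rho z) * Rpower (r * s) lam)).
  { intros s zeta hzeta hs hx.
    eapply Rle_trans; [apply (M_bound rho eps s z zeta n hrho (proj2 hw)); auto; lra|].
    fold r (con (r * s)).
    replace (con (r * s) * (Rpower eps (2 - alpha rho z) * Rpower (r * s) lam))
      with (Rpower eps (2 - alpha rho z) * (con (r * s) * Rpower (r * s) lam)) by ring.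
    apply Rmult_le_compat_l; [lra|].
    apply Rmult_le_compat_l; [left; now apply hcon | apply pow_le_Rpower; lra]. }
  assert (hsup : forall zeta, bernstein_ellipse rho zeta -> Cmod (M rho z eps zeta) <= con (r * rho)).
  { intros zeta hzeta; rewrite <- (Rmult_1_r (con _)), <- g1.
    apply hMb; auto; intros k; now apply Cmod_chebT_ellipse. }
  split; [split; [apply M_analytic; auto; [apply hw | lra] | now exists (con (r * rho))]|].
  split; [now apply Hinf_norm_le|].
  split.
  { apply Linf_norm_le; [generalize (hcon _ x2); nra|].
    intros x hx; replace (con (r * 1) * eps)
      with (con (r * 1) * (Rpower eps (2 - alpha rho z) * Rpower (r * 1) lam)) by now rewrite g2.
    apply hMb; auto.
    intros k; rewrite pow1; now apply Cmod_chebT_segment. }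
  split; [|rewrite <- g3; apply hMb; auto; intros k; rewrite <- hJ; apply Cmod_chebT_joukowski; fold r; lra].
  destruct n as [|N]; [lia|].
  eapply Rle_trans; [|apply (M_lower_bound rho eps z N); auto; lra].
  fold r; rewrite <- g3.
  assert (hup : Rpower (r * r) lam <= (r * r) ^ S (S N)).
  { rewrite <- (Rpower_pow (S (S N))) by lra; apply Rle_Rpower; [lra|].
    rewrite (S_INR (S N)); lra. }
  replace ((1 - / r ^ 2) * / r ^ 2 / 4 * (Rpower eps (2 - alpha rho z) * Rpower (r * r) lam))
    with (Rpower eps (2 - alpha rho z) * ((1 - / r ^ 2) * / r ^ 2 / 4 * Rpower (r * r) lam)) by ring.
  apply Rmult_le_compat_l; [lra|].
  apply Rle_trans with ((1 - / r ^ 2) * / r ^ 2 / 4 * (r * r) ^ S (S N)).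
  { apply Rmult_le_compat_l; [|exact hup].
    unfold Rdiv; repeat apply Rmult_le_pos; lra. }
  replace (r ^ (2 * S N)) with ((r * r) ^ S N) by (rewrite pow_mult; f_equal; simpl; ring).
  assert (1 <= (r * r) ^ N) by (apply pow_R1_Rle; nra).
  replace ((1 - / r ^ 2) * / r ^ 2 / 4 * (r * r) ^ S (S N))
    with (((r * r) ^ S N - (r * r) ^ N) / 4) by (simpl; field; lra).
  lra.
Qed.
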